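(* Let $j\ge 1$ be such that $g_j>0$ (i.e. $\lambda_j$ is a simple eigenvalue of $\Sigma$), and suppose $\delta_j<1/2$. Then for every integer $p\ge 1$, $$\Big\|\hat P_j-\sum_{n=0}^{p-1}P_j^{(n)}\Big\|_2\le 4g_j^{-1/2}\,\big\|P_jE|R_j|^{1/2}\big\|_2\,\frac{(4\delta_j')^{p-1}}{(1-2\delta_j)^2}.$$
   Context: Setting. $\mathcal H$ is a separable Hilbert space of dimension $d\in\{2,3,\dots\}\cup\{\infty\}$; $(u\otimes v)x=\langle v,x\rangle u$. $\Sigma$ and $\hat\Sigma$ are self-adjoint compact operators on $\mathcal H$ (positive if $d=\infty$) with $\Sigma=\sum_{k\ge1}\lambda_kP_k$, $P_k=u_k\otimes u_k$, and $\hat\Sigma=\sum_{k\ge1}\hat\lambda_k\hat P_k$, $\hat P_k=\hat u_k\otimes\hat u_k$, where $\lambda_1\ge\lambda_2\ge\cdots$, $\hat\lambda_1\ge\hat\lambda_2\ge\cdots$, and $(u_k)$, $(\hat u_k)$ are orthonormal bases of $\mathcal H$. Put $E=\hat\Sigma-\Sigma$. $\|\cdot\|_\infty$ is the operator norm, $\|\cdot\|_2$ the Hilbert–Schmidt norm. Spectral gap: $g_1=\lambda_1-\lambda_2$ and $g_j=\min(\lambda_{j-1}-\lambda_j,\lambda_j-\lambda_{j+1})$ for $j\ge2$ (with $\lambda_{d+1}:=-\infty$ if $d<\infty$). For $g_j>0$ the reduced resolvent is $R_j=\sum_{k\ne j}(\lambda_k-\lambda_j)^{-1}P_k$, so $|R_j|^{1/2}=\sum_{k\neq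 j}|\lambda_k-\lambda_j|^{-1/2}P_k$. Define $$\delta_j=\big\|(|R_j|^{1/2}+g_j^{-1/2}P_j)E(|R_j|^{1/2}+g_j^{-1/2}P_j)\big\|_\infty,$$ $$\delta_j'=\max\big(\||R_j|^{1/2}E|R_j|^{1/2}\|_\infty,\ g_j^{-1/2}\||R_j|^{1/2}EP_j\|_2,\ g_j^{-1}\|P_jEP_j\|_2\big).$$ For $n\ge0$, $$P_j^{(n)}=(-1)^{n+1}\sum_{\substack{k_1,\dots,k_{n+1}\ge0\\k_1+\dots+k_{n+1}=n}}R_j^{(k_1)}ER_j^{(k_2)}\cdots R_j^{(k_n)}ER_j^{(k_{n+1})},$$ where $R_j^{(0)}=-P_j$ and $R_j^{(k)}=R_j^k$ for $k>0$ (so $P_j^{(0)}=P_j$). Convention $0^0=1$. *)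

(* Defs.v *)
From HB Require Import structures.
From mathcomp Require Import all_boot all_order all_algebra complex.
From mathcomp Require Import all_classical all_reals all_analysis.

Set Implicit Arguments.
Unset Strict Implicit.
Unset Printing Implicit Defensive.

Import Order.TTheory GRing.Theory Num.Theory.
Import numFieldNormedType.Exports.

Local Open Scope classical_set_scope.
Local Open Scope ring_scope.

(* The Hilbert space may be real or complex; everything below is written
   uniformly for both scalar fields. *)
Variant scalar_kind := RealScalars | ComplexScalars.

Definition sfield (R : realType) (s : scalar_kind) : numFieldType :=
  match s with RealScalars => R | ComplexScalars => R[i]%C end.

Definition sconj (R : realType) (s : scalar_kind) : sfield R s -> sfield R s :=
  match s return sfield R s -> sfield R s with
  | RealScalars => fun x : R => x
  | ComplexScalars => fun z : R[i]%C => conjc z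
  end.

Definition sRe (R : realType) (s : scalar_kind) : sfield R s -> R :=
  match s return sfield R s -> R with
  | RealScalars => fun x : R => x
  | ComplexScalars => fun z : R[i]%C => complex.Re z
  end.

Definition sreal (R : realType) (s : scalar_kind) : R -> sfield R s :=
  match s return R -> sfield R s with
  | RealScalars => fun x : R => x
  | ComplexScalars => fun x : R => real_complex R x
  end.

(* A dimension is a natural number ([Some n]) or infinity ([None]).  Indices
   start at 0, so that the index k here is the index k + 1 on paper. *)
Definition in_dim (d : option nat) (k : nat) : bool :=
  if d is Some n then (k < n)%N else true.

Section Hilbert.
Variables (R : realType) (s : scalar_kind).
Local Notation K := (sfield R s).
Variables (H : completeNormedModType K) (ip : H -> H -> K).

(* Linear in the second argument; the last clause says that the norm of H is
   the one induced by the inner product. *)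
Definition inner_product : Prop :=
  [/\ forall (z x y : H) (a : K), ip z (a *: x + y) = a * ip z x + ip z y,
      forall x y : H, ip y x = sconj (ip x y)
    & forall x : H, ip x x = `|x| ^+ 2].

(* The norm of a [normedModType K] takes its values in K. *)
Definition rnorm (x : H) : R := sRe `|x|.

Definition tensor (u v : H) (x : H) : H := ip v x *: u.

Definition eigenproj (u : nat -> H) (k : nat) : H -> H := tensor (u k) (u k).

Definition orthonormal_basis (d : option nat) (u : nat -> H) : Prop :=
  (forall k l, in_dim d k -> in_dim d l -> ip (u k) (u l) = (k == l)%:R) /\
  (forall x, \sum_(0 <= k < n | in_dim d k) eigenproj u k x @[n --> \oo] --> x).

Definition self_adjoint (A : H -> H) : Prop :=
  forall x y, ip (A x) y = ip x (A y).

Definition positive_op (A : H -> H) : Prop := forall x, 0 <= ip x (A x).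

Definition compact_op (A : H -> H) : Prop :=
  precompact (A @` [set x | `|x| <= 1]).

(* A = \sum_k a_k P_k, with strong convergence of the series. *)
Definition spectral_sum (d : option nat) (A : H -> H) (a : nat -> R)
    (u : nat -> H) : Prop :=
  forall x, \sum_(0 <= k < n | in_dim d k) sreal s (a k) *: eigenproj u k x
              @[n --> \oo] --> A x.

Definition opnorm (A : H -> H) : \bar R :=
  ereal_sup [set (rnorm (A x))%:E | x in [set x | `|x| <= 1]].

(* The value does not depend on the orthonormal basis u. *)
Definition hsnorm (d : option nat) (u : nat -> H) (A : H -> H) : \bar R :=
  sqrte (\sum_(0 <= k <oo | in_dim d k) ((rnorm (A (u k)) ^+ 2)%:E))%E.

Section Perturbation.
Variables (d : option nat) (lam : nat -> R) (u : nat -> H).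

Definition nonincreasing_eigenvalues : Prop :=
  forall k, in_dim d k.+1 -> lam k.+1 <= lam k.

(* For the last index of a finite-dimensional space the missing eigenvalue is
   -oo, so that the second term of the minimum drops out. *)
Definition spectral_gap (j : nat) : R :=
  match j with
  | 0 => lam 0 - lam 1
  | i.+1 =>
      if in_dim d j.+1 then Num.min (lam i - lam j) (lam j - lam j.+1)
      else lam i - lam j
  end.

Definition off_diag (j : nat) (a : nat -> R) (x : H) : H :=
  limn (fun n => \sum_(0 <= k < n | in_dim d k && (k != j))
                   sreal s (a k) *: eigenproj u k x).

Definition resolvent (j : nat) : H -> H :=
  off_diag j (fun k => (lam k - lam j)^-1).

(* |R_j|^{1/2} *)
Definition sqrt_abs_resolvent (j : nat) : H -> H :=
  off_diag j (fun k => (Num.sqrt `|lam k - lam j|)^-1).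

Variable E : H -> H.

Definition delta (j : nat) : \bar R :=
  let W := fun x =>
    sqrt_abs_resolvent j x + sreal s (Num.sqrt (spectral_gap j))^-1 *: eigenproj u j x in
  opnorm (W \o E \o W).

Definition delta' (j : nat) : \bar R :=
  let S := sqrt_abs_resolvent j in
  let P := eigenproj u j in
  maxe (opnorm (S \o E \o S))
    (maxe (((Num.sqrt (spectral_gap j))^-1)%:E * hsnorm d u (S \o E \o P))
          (((spectral_gap j)^-1)%:E * hsnorm d u (P \o E \o P)))%E.

(* R_j^{(k)} *)
Definition resolvent_pow (j k : nat) (x : H) : H :=
  if k is 0 then - eigenproj u j x else iter k (resolvent j) x.

(* R_j^{(k_1)} E R_j^{(k_2)} ... E R_j^{(k_m)} for ks = [:: k_1; ...; k_m] *)
Fixpoint resolvent_word (j : nat) (ks : seq nat) : H -> H :=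
  match ks with
  | [::] => id
  | [:: k] => resolvent_pow j k
  | k :: ks' => resolvent_pow j k \o E \o resolvent_word j ks'
  end.

(* P_j^{(n)}; each k_i is at most n, hence the range 'I_n.+1. *)
Definition proj_term (j n : nat) (x : H) : H :=
  (-1) ^+ n.+1 *:
    \sum_(k : (n.+1).-tuple 'I_n.+1 | (\sum_(i < n.+1) tnth k i == n)%N)
      resolvent_word j (map val k) x.

End Perturbation.
End Hilbert.

(* Main.v *)
(**
  Write S = |R_j|^{1/2}, W = S + g^{-1/2} P_j, theta = lamh_j - lam_j. No contour integral
  is needed: expand the resolvents of Sigma and Sigmah in Laurent series around lam_j, the
  latter in the annulus between |theta| and the other eigenvalues of Sigmah - lam_j, with
  coefficients Rh^(k), k in Z, where Rh^(-m) = - theta^m hat P_j for m >= 0. Comparing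
  coefficients in the second resolvent identity and iterating p times gives
    hat P_j - sum_{n < p} P_j^(n)
      = (-1)^(p+1) sum_{k_0 + ... + k_p = p} Rh^(k_0) E R_j^(k_1) ... E R_j^(k_p)
  with k_0 in Z and k_1, ..., k_p >= 0. The series is cut off at k_i <= L, with an error
  that is O(2^-L).

  Since ||W E W|| = delta < 1/2, min-max gives |theta| <= delta g and
  |lamh_k - lam_j| >= g / 2 for k <> j. Writing each R_j^(k) as U M U with U = S or
  U = g^{-1/2} P_j, every word is a rank one operator of norm at most
    2^k_0 g^{-1/2} ||P_j E S|| delta'^(p-1) (1 - 2 delta)^-2,
  and the sum of 2^k_0 = 2^(p - k_1 - ... - k_p) over all words is 4^p.
*)
Require Import Defs.
From HB Require Import structures.
From mathcomp Require Import all_boot all_order all_algebra complex.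
From mathcomp Require Import all_classical all_reals all_analysis.
From mathcomp Require Import ring lra zify.

Set Implicit Arguments.
Unset Strict Implicit.
Unset Printing Implicit Defensive.

Import Order.TTheory GRing.Theory Num.Theory.
Import numFieldNormedType.Exports.

Local Open Scope ring_scope.

(** * Scalars and inner products *)

(** The obstacle is the perturbed factor: hat P_j and the resolvent of Sigmah are diagonal in
    another basis than the weight W. Duality removes it: hat P_j E U and hat R E U are bounded
    through their adjoints, that is, by U E on an eigenvector q of Sigmah, or on a solution X of
    (Sigmah - lam_j) X = y orthogonal to uh_j. In the coordinates w = W^-1 q the eigenvector lies in
    the cone where P_j w dominates (1 - P_j) w, and the orthogonal complement of uh_j lies in the
    opposite cone. Each such estimate solves an inequality with delta on both sides and loses one
    factor (1 - 2 delta)^-1. The base 2 in 2^k_0 is the separation of the spectrum at g/2: positive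
    coefficients have norm at most (2/g)^k_0, negative ones |theta|^m <= (g/2)^m. The
    Hilbert-Schmidt norm costs nothing because a word has rank one: if k_0 <= 0 it contains hat P_j,
    and if k_0 > 0 some other k_i is 0 and brings in P_j. The cut-off error needs only an operator
    norm bound, as the Hilbert-Schmidt norm is read on finitely many basis vectors and L goes to
    infinity before their number does. *)

Section Scalars.
Variables (R : realType) (s : scalar_kind).
Local Notation K := (sfield R s).

Lemma sreal_is_zmod_morphism : zmod_morphism (@sreal R s).
Proof. by case: s => // x y /=; rewrite rmorphB. Qed.

Lemma sreal_is_monoid_morphism : monoid_morphism (@sreal R s).
Proof. by case: s; split=> // x y /=; rewrite rmorphM. Qed.

HB.instance Definition _ := GRing.isZmodMorphism.Build R K (@sreal R s)
  sreal_is_zmod_morphism.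
HB.instance Definition _ := GRing.isMonoidMorphism.Build R K (@sreal R s)
  sreal_is_monoid_morphism.

Lemma sconj_is_zmod_morphism : zmod_morphism (@sconj R s).
Proof. by case: s => // x y /=; rewrite rmorphB. Qed.

Lemma sconj_is_monoid_morphism : monoid_morphism (@sconj R s).
Proof.
by case: s; split=> //= [|x y]; [rewrite /= oppr0 | exact: (rmorphM (@conjc R))].
Qed.

HB.instance Definition _ := GRing.isZmodMorphism.Build K K (@sconj R s)
  sconj_is_zmod_morphism.
HB.instance Definition _ := GRing.isMonoidMorphism.Build K K (@sconj R s)
  sconj_is_monoid_morphism.

Lemma sRe_is_zmod_morphism : zmod_morphism (@sRe R s).
Proof. by case: s => // -[a b] [a' b']. Qed.

HB.instance Definition _ := GRing.isZmodMorphism.Build K R (@sRe R s)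
  sRe_is_zmod_morphism.

Lemma sconjK : involutive (@sconj R s).
Proof. by case: s => // z; exact: conjcK. Qed.

Lemma sconj_sreal (a : R) : sconj (sreal s a) = sreal s a.
Proof. by case: s => //=; exact: conjc_real. Qed.

Lemma sRe_sreal (a : R) : sRe (sreal s a) = a.
Proof. by case: s. Qed.

Lemma sRe_srealM (a : R) (z : K) : sRe (sreal s a * z) = a * sRe z.
Proof.
case: s z => // -[x y]; by rewrite /= mul0r subr0.
Qed.

Lemma sRe_conj (z : K) : sRe (sconj z) = sRe z.
Proof. by case: s z => // -[]. Qed.

Lemma mul_sconj (z : K) : z * sconj z = `|z| ^+ 2.
Proof.
case: s z => [z|[x y]]; first by rewrite -expr2 real_normK // num_real.
rewrite -add_Re2_Im2.
change ((x +i* y) * (x -i* y) = (x ^+ 2 + y ^+ 2) +i* 0)%C.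
by congr Complex; ring.
Qed.

(** A nonnegative element of [R[i]] is real for the order in use, so norms with values in [K] can be
    handled as elements of [R]. *)
Lemma ge0_sreal (z : K) : 0 <= z -> z = sreal s (sRe z).
Proof.
case: s z => // z z0 /=; rewrite RRe_real //; exact: ger0_real.
Qed.

Lemma ler_sreal (a b : R) : (sreal s a <= sreal s b) = (a <= b).
Proof. by case: s => //; exact: lecR. Qed.

Lemma ltr_sreal (a b : R) : (sreal s a < sreal s b) = (a < b).
Proof. by case: s => //; exact: ltcR. Qed.

Definition snorm (z : K) : R := sRe `|z|.

Lemma snormE (z : K) : `|z| = sreal s (snorm z).
Proof. exact: ge0_sreal. Qed.

Lemma sRe_ge0 (z : K) : 0 <= z -> 0 <= sRe z.
Proof. by move=> z0; rewrite -ler_sreal -ge0_sreal // rmorph0. Qed.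

Lemma snorm_ge0 (z : K) : 0 <= snorm z.
Proof. exact: sRe_ge0. Qed.

Lemma sreal_inj : injective (@sreal R s).
Proof. exact: fmorph_inj. Qed.

Lemma snormM (y z : K) : snorm (y * z) = snorm y * snorm z.
Proof. by apply: sreal_inj; rewrite rmorphM /= -!snormE normrM. Qed.

Lemma snorm_sreal (a : R) : snorm (sreal s a) = `|a|.
Proof.
apply: sreal_inj; rewrite -snormE.
have [a0|a0] := leP 0 a.
  rewrite (ger0_norm a0) ger0_norm //.
  by rewrite -[leLHS](rmorph0 (@sreal R s)) ler_sreal.
rewrite (ltr0_norm a0) ltr0_norm ?rmorphN //.
by rewrite -[ltRHS](rmorph0 (@sreal R s)) ltr_sreal.
Qed.

Lemma snorm_eq0 (z : K) : (snorm z == 0) = (z == 0).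
Proof. by rewrite -[RHS]normr_eq0 snormE -(inj_eq sreal_inj) rmorph0. Qed.

Lemma snorm0 : snorm (0 : K) = 0.
Proof. by apply/eqP; rewrite snorm_eq0. Qed.

Lemma mul_sconjE (z : K) : z * sconj z = sreal s (snorm z ^+ 2).
Proof. by rewrite mul_sconj snormE rmorphXn. Qed.

Lemma snorm_conj (z : K) : snorm (sconj z) = snorm z.
Proof.
apply: (@pexpIrn _ 2) => //; rewrite ?nnegrE ?snorm_ge0 //.
by apply: sreal_inj; rewrite -!mul_sconjE sconjK mulrC.
Qed.

Lemma sRe_le_snorm (z : K) : sRe z <= snorm z.
Proof.
rewrite /snorm; case: s z => [z|[x y]]; first exact: ler_norm.
rewrite normc_def /= -[leLHS]/x.
apply: le_trans (ler_norm x) _; rewrite -sqrtr_sqr ler_wsqrtr //.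
by rewrite lerDl sqr_ge0.
Qed.

End Scalars.

Section InnerProduct.
Variables (R : realType) (s : scalar_kind).
Local Notation K := (sfield R s).
Variables (H : completeNormedModType K) (ip : H -> H -> K).
Hypothesis ipP : inner_product ip.

Lemma ip_linear (z x y : H) (a : K) : ip z (a *: x + y) = a * ip z x + ip z y.
Proof. by case: ipP. Qed.

Lemma ipC (x y : H) : ip y x = sconj (ip x y).
Proof. by case: ipP. Qed.

Lemma ipDr (z x y : H) : ip z (x + y) = ip z x + ip z y.
Proof. by rewrite -{1}(scale1r x) ip_linear mul1r. Qed.

Lemma ip0r (z : H) : ip z 0 = 0.
Proof. by apply: (addIr (ip z 0)); rewrite -ipDr !add0r. Qed.

Lemma ipZr (z x : H) (a : K) : ip z (a *: x) = a * ip z x.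
Proof. by rewrite -[in LHS](addr0 (a *: x)) ip_linear ip0r addr0. Qed.

Lemma ipNr (z x : H) : ip z (- x) = - ip z x.
Proof. by rewrite -scaleN1r ipZr mulN1r. Qed.

Lemma ipBr (z x y : H) : ip z (x - y) = ip z x - ip z y.
Proof. by rewrite ipDr ipNr. Qed.

Lemma ip_sumr (I : Type) (r : seq I) (p : pred I) (F : I -> H) z :
  ip z (\sum_(i <- r | p i) F i) = \sum_(i <- r | p i) ip z (F i).
Proof. by apply: big_morph => [x y|]; rewrite ?ipDr ?ip0r. Qed.

Lemma ipDl (z x y : H) : ip (x + y) z = ip x z + ip y z.
Proof. by rewrite ipC ipDr rmorphD /= -!ipC. Qed.

Lemma ipZl (z x : H) (a : K) : ip (a *: x) z = sconj a * ip x z.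
Proof. by rewrite ipC ipZr rmorphM /= -!ipC. Qed.

Lemma ipNl (z x : H) : ip (- x) z = - ip x z.
Proof. by rewrite ipC ipNr rmorphN /= -!ipC. Qed.

Lemma ipBl (z x y : H) : ip (x - y) z = ip x z - ip y z.
Proof. by rewrite ipDl ipNl. Qed.

Lemma normE (x : H) : `|x| = sreal s (rnorm x).
Proof. exact: ge0_sreal. Qed.

Lemma ipxx (x : H) : ip x x = sreal s (rnorm x ^+ 2).
Proof. by case: ipP => _ _ ->; rewrite normE rmorphXn. Qed.

Lemma rnorm_ge0 (x : H) : 0 <= rnorm x.
Proof. exact: sRe_ge0. Qed.

Lemma rnorm0 : rnorm (0 : H) = 0.
Proof. by apply: (@sreal_inj R s); rewrite -normE normr0 rmorph0. Qed.

Lemma rnorm_eq0 (x : H) : (rnorm x == 0) = (x == 0).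
Proof. by rewrite -[RHS]normr_eq0 normE -(inj_eq (@sreal_inj R s)) rmorph0. Qed.

Lemma rnormZ (a : K) (x : H) : rnorm (a *: x) = snorm a * rnorm x.
Proof. by apply: (@sreal_inj R s); rewrite rmorphM /= -normE -snormE -normE normrZ. Qed.

Lemma rnormZ_real (a : R) (x : H) : rnorm (sreal s a *: x) = `|a| * rnorm x.
Proof. by rewrite rnormZ snorm_sreal. Qed.

Lemma rnormN (x : H) : rnorm (- x) = rnorm x.
Proof. by rewrite /rnorm normrN. Qed.

Lemma rnormD (x y : H) : rnorm (x + y) <= rnorm x + rnorm y.
Proof. by rewrite -(ler_sreal s) rmorphD /= -!normE ler_normD. Qed.

Lemma rnormB (x y : H) : rnorm (x - y) <= rnorm x + rnorm y.
Proof. by rewrite -(rnormN y) rnormD. Qed.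

Lemma rnorm_sum (I : Type) (r : seq I) (p : pred I) (F : I -> H) :
  rnorm (\sum_(i <- r | p i) F i) <= \sum_(i <- r | p i) rnorm (F i).
Proof.
elim/big_rec2: _ => [|i y x _ le_xy]; first by rewrite rnorm0.
by apply: le_trans (rnormD _ _) _; rewrite lerD2l.
Qed.

Definition rip (x y : H) : R := sRe (ip x y).

Lemma ripC x y : rip x y = rip y x.
Proof. by rewrite /rip ipC sRe_conj. Qed.

Lemma ripDr z x y : rip z (x + y) = rip z x + rip z y.
Proof. by rewrite /rip ipDr raddfD. Qed.

Lemma ripNr z x : rip z (- x) = - rip z x.
Proof. by rewrite /rip ipNr raddfN. Qed.

Lemma ripBr z x y : rip z (x - y) = rip z x - rip z y.
Proof. by rewrite ripDr ripNr. Qed.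

Lemma ripDl z x y : rip (x + y) z = rip x z + rip y z.
Proof. by rewrite ripC ripDr !(ripC z). Qed.

Lemma ripNl z x : rip (- x) z = - rip x z.
Proof. by rewrite ripC ripNr ripC. Qed.

Lemma ripBl z x y : rip (x - y) z = rip x z - rip y z.
Proof. by rewrite ripDl ripNl. Qed.

Lemma ripZr z x a : rip z (sreal s a *: x) = a * rip z x.
Proof. by rewrite /rip ipZr sRe_srealM. Qed.


Lemma ripxx x : rip x x = rnorm x ^+ 2.
Proof. by rewrite /rip ipxx sRe_sreal. Qed.

Lemma rnormB_sqr x y :
  rnorm (x - y) ^+ 2 = rnorm x ^+ 2 - 2 * rip x y + rnorm y ^+ 2.
Proof. by rewrite -!ripxx ripBl !ripBr (ripC y x); ring. Qed.

Lemma rnormD_sqr x y :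
  rnorm (x + y) ^+ 2 = rnorm x ^+ 2 + 2 * rip x y + rnorm y ^+ 2.
Proof. by rewrite -!ripxx ripDl !ripDr (ripC y x); ring. Qed.

(** Cauchy-Schwarz: [t * c] is the coefficient of the projection of [y] on [x], and the squared norm
    of the orthogonal component is nonnegative. *)
Lemma snorm_ip_le (x y : H) : snorm (ip x y) <= rnorm x * rnorm y.
Proof.
have [->|x0] := eqVneq x 0.
  by rewrite ipC ip0r rmorph0 rnorm0 mul0r snorm0.
have nx : 0 < rnorm x by rewrite lt_def rnorm_eq0 x0 rnorm_ge0.
have nx2 : 0 < rnorm x ^+ 2 by rewrite exprn_gt0.
pose c := ip x y; pose t : R := (rnorm x ^+ 2)^-1.
have := sqr_ge0 (rnorm (y - (sreal s t * c) *: x)).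
rewrite rnormB_sqr /rip ipZr (ipC x y) -/c -mulrA mul_sconjE sRe_srealM sRe_sreal.
rewrite rnormZ snormM snorm_sreal ger0_norm; last by rewrite invr_ge0 ltW.
set n := snorm c; set m := rnorm y => h.
have {}h : n ^+ 2 <= (rnorm x * m) ^+ 2.
  rewrite exprMn -subr_ge0.
  suff -> : rnorm x ^+ 2 * m ^+ 2 - n ^+ 2 = rnorm x ^+ 2 * (m ^+ 2 - 2 * (t * n ^+ 2) + (t * n * rnorm x) ^+ 2).
    by rewrite mulr_ge0 // ltW.
  by rewrite /t; field; rewrite gt_eqF.
by rewrite -(@ler_pXn2r _ 2) // nnegrE ?mulr_ge0 ?rnorm_ge0 ?snorm_ge0.
Qed.

Lemma rip_le (x y : H) : rip x y <= rnorm x * rnorm y.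
Proof. exact: le_trans (sRe_le_snorm _) (snorm_ip_le _ _). Qed.

Lemma rip_ge (x y : H) : - (rnorm x * rnorm y) <= rip x y.
Proof. by rewrite lerNl -ripNr -(rnormN y) rip_le. Qed.

(* Applied with x = T y and z = T^* x. *)
Lemma rnorm_le_adjoint (x y z : H) (M : R) :
  0 <= M -> rip x x = rip z y -> rnorm z <= M * rnorm x -> rnorm x <= M * rnorm y.
Proof.
move=> M0 xzy zx; have [->|x0] := eqVneq x 0.
  by rewrite rnorm0 mulr_ge0 ?rnorm_ge0.
have nx : 0 < rnorm x by rewrite lt_def rnorm_eq0 x0 rnorm_ge0.
rewrite -(ler_pM2l nx) -expr2 -ripxx xzy.
apply: le_trans (rip_le _ _) _; rewrite mulrA (mulrC (rnorm x)).
by rewrite ler_wpM2r // rnorm_ge0.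
Qed.

End InnerProduct.
(** * Diagonal operators in an orthonormal basis *)

Section Convergence.
Variables (R : realType) (s : scalar_kind).
Local Notation K := (sfield R s).
Variables (H : completeNormedModType K) (ip : H -> H -> K).
Hypothesis ipP : inner_product ip.

Lemma cvg_rnorm_lt (f : nat -> H) (y : H) (e : R) : (f @ \oo --> y)%classic ->
  0 < e -> exists N, forall n, (N <= n)%N -> rnorm (y - f n) < e.
Proof.
move=> fy e0; have e0' : 0 < sreal s e by rewrite -[ltLHS](rmorph0 (@sreal R s)) ltr_sreal.
have /cvgrPdist_lt/(_ _ e0')[N _ fN] := fy.
by exists N => n /fN /=; rewrite normE ltr_sreal.
Qed.

(** Continuity of the inner product, by Cauchy-Schwarz. The threshold [N] is there because a
    coordinate of a partial sum takes its final value only once the sum has passed its index. *)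
Lemma ip_lim_eq (f f' : nat -> H) (y y' z z' : H) (N : nat) :
  (f @ \oo --> y)%classic -> (f' @ \oo --> y')%classic ->
  (forall n, (N <= n)%N -> ip z (f n) = ip z' (f' n)) -> ip z y = ip z' y'.
Proof.
move=> fy fy' ff'; apply/eqP; rewrite -subr_eq0 -snorm_eq0 eq_le snorm_ge0 andbT.
apply/ler_addgt0Pl => e e0; rewrite addr0.
pose m := rnorm z + rnorm z' + 1.
have m0 : 0 < m by rewrite ltr_wpDl ?addr_ge0 ?rnorm_ge0.
have em0 : 0 < e / m by rewrite divr_gt0.
have [N1 h1] := cvg_rnorm_lt fy em0; have [N2 h2] := cvg_rnorm_lt fy' em0.
pose n := maxn N (maxn N1 N2).
have nN : (N <= n)%N by rewrite leq_maxl.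
have nN1 : (N1 <= n)%N by rewrite /n maxnCA leq_maxl.
have nN2 : (N2 <= n)%N by rewrite /n maxnA leq_maxr.
have -> : ip z y - ip z' y' = ip z (y - f n) - ip z' (y' - f' n).
  by rewrite !(ipBr ipP) ff' //; ring.
rewrite -(ler_sreal s) -snormE.
apply: le_trans (ler_normB _ _) _; rewrite !snormE -rmorphD ler_sreal.
apply: (@le_trans _ _ (rnorm z * (e / m) + rnorm z' * (e / m))).
  apply: lerD; apply: le_trans (snorm_ip_le ipP _ _) _;
    by rewrite ler_wpM2l ?rnorm_ge0 // ltW ?h1 ?h2.
rewrite -mulrDl mulrCA ger_pMr // ler_pdivrMr // mul1r.
by rewrite lerDl ler01.
Qed.

Lemma rip_lim_ge0 (f : nat -> H) (y z : H) :
  (f @ \oo --> y)%classic -> (forall n, 0 <= rip ip z (f n)) -> 0 <= rip ip z y.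
Proof.
move=> fy f0; apply/ler_addgt0Pl => e e0.
pose m := rnorm z + 1.
have m0 : 0 < m by rewrite ltr_wpDl ?rnorm_ge0.
have em0 : 0 < e / m by rewrite divr_gt0.
have [N h] := cvg_rnorm_lt fy em0; have {}h := h N (leqnn _).
have -> : rip ip z y = rip ip z (f N) + rip ip z (y - f N).
  by rewrite -(ripDr ipP) addrCA subrr addr0.
have : - e <= rip ip z (y - f N).
  apply: le_trans (rip_ge ipP _ _); rewrite lerN2.
  apply: (@le_trans _ _ (rnorm z * (e / m))).
    by rewrite ler_wpM2l ?rnorm_ge0 // ltW.
  by rewrite mulrCA ger_pMr // ler_pdivrMr // mul1r lerDl ler01.
by move: (f0 N); lra.
Qed.

End Convergence.

Section Diagonal.
Variables (R : realType) (s : scalar_kind).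
Local Notation K := (sfield R s).
Variables (H : completeNormedModType K) (ip : H -> H -> K).
Hypothesis ipP : inner_product ip.
Variables (d : option nat) (u : nat -> H).
Hypothesis uP : orthonormal_basis ip d u.

Let u_orth k l : in_dim d k -> in_dim d l -> ip (u k) (u l) = (k == l)%:R.
Proof. by case: uP => h _; exact: h. Qed.

Lemma rnorm_basis k : in_dim d k -> rnorm (u k) = 1.
Proof.
move=> dk; apply: (@pexpIrn _ 2) => //; rewrite ?nnegrE ?rnorm_ge0 ?ler01 //.
apply: (@sreal_inj R s); rewrite -(ipxx ipP) u_orth // eqxx.
by rewrite expr1n [RHS](rmorph1 (@sreal R s)).
Qed.

Lemma ip_basis_sum (r : seq nat) (p : pred nat) (c : nat -> K) l :
  uniq r -> (forall k, p k -> in_dim d k) -> in_dim d l ->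
  ip (u l) (\sum_(k <- r | p k) c k *: u k) = if (l \in r) && p l then c l else 0.
Proof.
move=> ur pd dl; rewrite (ip_sumr ipP).
rewrite (eq_bigr (fun k => if k == l then c l else 0)); last first.
  move=> k /pd dk; rewrite (ipZr ipP) u_orth // eq_sym.
  by case: eqP => [->|_]; rewrite ?mulr1 ?mulr0.
rewrite -big_mkcondr /=; case: ifPn => [/andP[lr pl]|nlr].
  rewrite (big_rem l) //= pl eqxx /= big1_seq ?addr0 // => i /andP[/andP[_ /eqP ->]].
  by rewrite mem_rem_uniq // !inE eqxx.
rewrite big1_seq // => i /andP[/andP[pi /eqP il] ir].
by move: nlr; rewrite -il ir pi.
Qed.

Lemma pythagoras (r : seq nat) (p : pred nat) (c : nat -> K) :
  uniq r -> (forall k, p k -> in_dim d k) ->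
  rnorm (\sum_(k <- r | p k) c k *: u k) ^+ 2 = \sum_(k <- r | p k) snorm (c k) ^+ 2.
Proof.
move=> + pd; elim: r => [_|k r IH /= /andP[kr ur]]; first by rewrite !big_nil rnorm0 expr0n.
rewrite !big_cons; case: ifP => pk; last exact: IH.
rewrite (rnormD_sqr ipP) IH // rnormZ rnorm_basis ?pd // mulr1.
rewrite /rip (ipZl ipP) ip_basis_sum ?pd // (negPf kr) /= mulr0 raddf0.
by ring.
Qed.

Definition bdd (a : nat -> R) := exists M, forall k, in_dim d k -> `|a k| <= M.

Definition psum (a : nat -> R) (x : H) (n : nat) : H :=
  \sum_(0 <= k < n | in_dim d k) sreal s (a k) *: eigenproj ip u k x.

(** Functional calculus in the basis [u]. The limit is meaningful only if the series converges,
    which is why [bdd a] accompanies almost every lemma about it. *)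
Definition diag (a : nat -> R) (x : H) : H := limn (psum a x).

Lemma psumE a x n :
  psum a x n = \sum_(0 <= k < n | in_dim d k) (sreal s (a k) * ip (u k) x) *: u k.
Proof. by apply: eq_bigr => k _; rewrite /eigenproj /tensor scalerA. Qed.

(** The expansion of [x] itself is Cauchy. By Pythagoras, bounded coefficients multiply the norm of
    each block of terms by at most [|M| + 1], so the new series is Cauchy too and completeness
    applies. *)
Lemma diag_cvg a x : bdd a -> (psum a x @ \oo --> diag a x)%classic.
Proof.
move=> [M aM].
have M1 : 0 < `|M| + 1 by rewrite ltr_wpDl.
have seriesE b : psum b x =
    series (fun k => if in_dim d k then (sreal s (b k) * ip (u k) x) *: u k else 0).
  by apply/funext => n; rewrite psumE /series /= -big_mkcond.
have xcvg : cvgn (psum (fun=> 1) x).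
  apply/cvg_ex; exists x; case: uP => _ /(_ x); apply: cvg_trans.
  apply: near_eq_cvg; apply: nearW => n; apply: eq_bigr => k _.
  by rewrite (rmorph1 (@sreal R s)) scale1r.
suff : cvgn (psum a x) by [].
move: xcvg; rewrite !seriesE => /cauchy_cvgP/cauchy_seriesP xc.
apply/cauchy_cvgP/cauchy_seriesP => e e0.
have M1' : 0 < sreal s (`|M| + 1) by rewrite -[ltLHS](rmorph0 (@sreal R s)) ltr_sreal.
have := xc (e / sreal s (`|M| + 1)) (divr_gt0 e0 M1').
apply: filterS => n /=; rewrite ltr_pdivlMr // => /le_lt_trans; apply.
rewrite -!big_mkcond !normE -rmorphM ler_sreal.
rewrite -(@ler_pXn2r _ 2) ?nnegrE ?mulr_ge0 ?rnorm_ge0 ?(ltW M1) //.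
rewrite exprMn !pythagoras ?iota_uniq // mulr_suml.
apply: ler_sum => k dk; rewrite (rmorph1 (@sreal R s)) mul1r snormM snorm_sreal exprMn mulrC.
rewrite ler_wpM2l ?sqr_ge0 // ler_pXn2r ?nnegrE ?(ltW M1) //.
by apply: le_trans (aM k dk) _; apply: le_trans (ler_norm M) _; rewrite lerDl ler01.
Qed.

Lemma coord_psum_lim a x y l : (psum a x @ \oo --> y)%classic -> in_dim d l ->
  ip (u l) y = sreal s (a l) * ip (u l) x.
Proof.
move=> ay dl; transitivity (ip (sreal s (a l) *: u l) x); last first.
  by rewrite (ipZl ipP) sconj_sreal.
apply: (ip_lim_eq ipP (N := l.+1) (f' := fun=> x) ay); first exact: cvg_cst.
move=> n ln; rewrite psumE ip_basis_sum ?iota_uniq //.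
by rewrite mem_index_iota ln dl (ipZl ipP) sconj_sreal.
Qed.

Lemma coord_diag a x l : bdd a -> in_dim d l ->
  ip (u l) (diag a x) = sreal s (a l) * ip (u l) x.
Proof. by move=> /(@diag_cvg a x); exact: coord_psum_lim. Qed.

Lemma basis_ext x y : (forall l, in_dim d l -> ip (u l) x = ip (u l) y) -> x = y.
Proof.
move=> xy; case: uP => _ h; rewrite -(cvg_lim (@norm_hausdorff _ _) (h x)).
rewrite -(cvg_lim (@norm_hausdorff _ _) (h y)); congr (limn _).
apply/funext => n; apply: eq_bigr => k dk.
by rewrite /eigenproj /tensor xy.
Qed.

Lemma eq_diag a b x : (forall k, in_dim d k -> a k = b k) -> diag a x = diag b x.
Proof.
move=> ab; congr (limn _); apply/funext => n.
by apply: eq_bigr => k dk; rewrite ab.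
Qed.

Lemma psum_lim_diag a x y : bdd a -> (psum a x @ \oo --> y)%classic -> y = diag a x.
Proof.
move=> ba ay; apply: basis_ext => l dl.
by rewrite coord_diag // (coord_psum_lim ay).
Qed.

Lemma diag_linear a k x y : bdd a -> diag a (k *: x + y) = k *: diag a x + diag a y.
Proof.
move=> ba; apply: basis_ext => l dl.
by rewrite coord_diag // !(ip_linear ipP) !coord_diag //; ring.
Qed.

Lemma diagD a x y : bdd a -> diag a (x + y) = diag a x + diag a y.
Proof. by move=> ba; rewrite -{1}(scale1r x) diag_linear // scale1r. Qed.

Lemma diag0r a : bdd a -> diag a 0 = 0.
Proof. by move=> ba; apply: (addIr (diag a 0)); rewrite -diagD // !add0r. Qed.

Lemma diagZ a k x : bdd a -> diag a (k *: x) = k *: diag a x.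
Proof. by move=> ba; rewrite -[k *: x]addr0 diag_linear // diag0r // addr0. Qed.

Lemma diagN a x : bdd a -> diag a (- x) = - diag a x.
Proof. by move=> ba; rewrite -scaleN1r diagZ // scaleN1r. Qed.

Lemma diagB a x y : bdd a -> diag a (x - y) = diag a x - diag a y.
Proof. by move=> ba; rewrite diagD // diagN. Qed.

Lemma bddM a b : bdd a -> bdd b -> bdd (fun k => a k * b k).
Proof.
move=> [M aM] [N bN]; exists (M * N) => k dk; rewrite normrM.
by rewrite ler_pM ?aM ?bN.
Qed.

Lemma bddD a b : bdd a -> bdd b -> bdd (fun k => a k + b k).
Proof.
move=> [M aM] [N bN]; exists (M + N) => k dk.
by apply: le_trans (ler_normD _ _) _; rewrite lerD ?aM ?bN.
Qed.

Lemma bdd_cst c : bdd (fun=> c).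
Proof. by exists `|c|. Qed.

Lemma bddN a : bdd a -> bdd (fun k => - a k).
Proof. by move=> [M aM]; exists M => k dk; rewrite normrN aM. Qed.

Lemma diag_comp a b x : bdd a -> bdd b ->
  diag a (diag b x) = diag (fun k => a k * b k) x.
Proof.
move=> ba bb; have bab := bddM ba bb; apply: basis_ext => l dl.
by rewrite !coord_diag // rmorphM mulrA.
Qed.

Lemma diag_add a b x : bdd a -> bdd b ->
  diag (fun k => a k + b k) x = diag a x + diag b x.
Proof.
move=> ba bb; have bab := bddD ba bb; apply: basis_ext => l dl.
by rewrite (ipDr ipP) !coord_diag // rmorphD mulrDl.
Qed.

Lemma diag_scale c a x : bdd a -> diag (fun k => c * a k) x = sreal s c *: diag a x.
Proof.
move=> ba; have bca := bddM (bdd_cst c) ba; apply: basis_ext => l dl.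
by rewrite (ipZr ipP) !coord_diag // rmorphM mulrA.
Qed.

Lemma diag1 x : diag (fun=> 1) x = x.
Proof.
apply: basis_ext => l dl; rewrite coord_diag ?(rmorph1 (@sreal R s)) ?mul1r //.
exact: bdd_cst.
Qed.

Lemma diag_cst c x : diag (fun=> c) x = sreal s c *: x.
Proof.
apply: basis_ext => l dl; rewrite coord_diag ?(ipZr ipP) //.
exact: bdd_cst.
Qed.

Lemma diag_eigen a l : bdd a -> in_dim d l -> diag a (u l) = sreal s (a l) *: u l.
Proof.
move=> ba dl; apply: basis_ext => k dk; rewrite coord_diag // (ipZr ipP) u_orth //.
by case: eqP => [->//|_]; rewrite !mulr0.
Qed.

(** Both sides are limits of the same finite sums, since [y] is the limit of its own expansion, that
    is of [psum] with coefficients 1. *)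
Lemma diag_sa a x y : bdd a -> ip (diag a x) y = ip x (diag a y).
Proof.
move=> ba; have b1 : bdd (fun=> 1) := bdd_cst 1.
have c1 := @diag_cvg _ y b1; rewrite diag1 in c1.
apply: (ip_lim_eq ipP (N := 0) c1 (@diag_cvg _ y ba)) => n _.
rewrite !psumE !(ip_sumr ipP); apply: eq_bigr => k dk.
rewrite !(ipZr ipP) (ipC ipP (u k) (diag a x)) coord_diag // (ipC ipP (u k) x).
by rewrite rmorphM /= sconj_sreal (rmorph1 (@sreal R s)) /=; ring.
Qed.

Lemma diag_rsa a x y : bdd a -> rip ip (diag a x) y = rip ip x (diag a y).
Proof. by move=> ba; rewrite /rip diag_sa. Qed.

Lemma rip_psum a x n :
  rip ip x (psum a x n) = \sum_(0 <= k < n | in_dim d k) a k * snorm (ip (u k) x) ^+ 2.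
Proof.
rewrite psumE /rip (ip_sumr ipP) raddf_sum; apply: eq_bigr => k _ /=.
by rewrite (ipZr ipP) (ipC ipP (u k) x) -mulrA mul_sconjE sRe_srealM sRe_sreal.
Qed.

Lemma rip_lim_psum_ge0 a x y : (psum a x @ \oo --> y)%classic ->
  (forall k, in_dim d k -> ip (u k) x != 0 -> 0 <= a k) -> 0 <= rip ip x y.
Proof.
move=> ay a0; apply: (rip_lim_ge0 ipP ay) => n; rewrite rip_psum.
apply: sumr_ge0 => k dk; have [->|nz] := eqVneq (ip (u k) x) 0.
  by rewrite snorm0 expr0n mulr0.
by rewrite mulr_ge0 ?sqr_ge0 ?a0.
Qed.

Lemma diag_ge0 a x : bdd a ->
  (forall k, in_dim d k -> ip (u k) x != 0 -> 0 <= a k) -> 0 <= rip ip x (diag a x).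
Proof. by move=> /(@diag_cvg a x); exact: rip_lim_psum_ge0. Qed.

Lemma rnorm_diag a x : bdd a ->
  rnorm (diag a x) ^+ 2 = rip ip x (diag (fun k => a k ^+ 2) x).
Proof.
move=> ba; rewrite -(ripxx ipP) diag_rsa // diag_comp //.
Qed.

Lemma rnorm_diag_le a b x : bdd a -> bdd b ->
  (forall k, in_dim d k -> ip (u k) x != 0 -> `|a k| <= `|b k|) ->
  rnorm (diag a x) <= rnorm (diag b x).
Proof.
move=> ba bb ab; rewrite -(@ler_pXn2r _ 2) ?nnegrE ?rnorm_ge0 //.
have ba2 := bddM ba ba; have bb2 := bddM bb bb.
rewrite !rnorm_diag // -subr_ge0 -(ripBr ipP) -scaleN1r.
rewrite -(rmorphN1 (@sreal R s)) -diag_scale // -diag_add //; last first.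
  exact: bddM (bdd_cst _) ba2.
apply: diag_ge0; first exact: bddD bb2 (bddM (bdd_cst _) ba2).
move=> k dk nz; rewrite mulN1r subr_ge0 -[leLHS]real_normK ?num_real //.
by rewrite -[leRHS]real_normK ?num_real // ler_pXn2r ?nnegrE ?ab.
Qed.

Lemma rnorm_diag_bound a M x : (forall k, in_dim d k -> `|a k| <= M) ->
  0 <= M -> rnorm (diag a x) <= M * rnorm x.
Proof.
move=> aM M0; rewrite -{1}(ger0_norm M0) -rnormZ_real -diag_cst.
apply: rnorm_diag_le => [||k dk _]; [by exists M|exact: bdd_cst|].
by rewrite (ger0_norm M0) aM.
Qed.


Lemma off_diagE j a x :
  off_diag ip d u j a x = diag (fun k => if k == j then 0 else a k) x.
Proof.
congr (limn _); apply/funext => n; rewrite /psum big_mkcondr /=.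
by apply: eq_bigr => k _; case: eqP => //=; rewrite rmorph0 scale0r.
Qed.

Lemma eigenprojE j x : in_dim d j ->
  eigenproj ip u j x = diag (fun k => (k == j)%:R) x.
Proof.
move=> dj; have bj : bdd (fun k => (k == j)%:R).
  by exists 1 => k _; case: eqP => _; rewrite ?normr1 ?normr0 ?ler01.
apply: basis_ext => l dl; rewrite coord_diag // /eigenproj /tensor (ipZr ipP) u_orth //.
by rewrite (rmorph_nat (@sreal R s)) mulrC; case: eqP => [->|_] //; rewrite !mul0r.
Qed.

End Diagonal.
(** * Min-max bounds for eigenvalues *)

Section MinMax.
Variables (R : realType) (s : scalar_kind).
Local Notation K := (sfield R s).
Variables (H : completeNormedModType K) (ip : H -> H -> K).
Hypothesis ipP : inner_product ip.
Variable d : option nat.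

Lemma in_dim_leq k m : (k <= m)%N -> in_dim d m -> in_dim d k.
Proof. by case: d => //= n km; exact: leq_ltn_trans. Qed.

(** Dimension count behind min-max: [m] linear conditions on the span of [a 0, ..., a m]. The
    coefficients form a row vector in the left kernel of a matrix with [m.+1] rows and [m]
    columns. *)
Lemma exists_orthogonal (a b : nat -> H) m : orthonormal_basis ip d a -> in_dim d m ->
  exists x, [/\ x != 0, forall k, in_dim d k -> (m < k)%N -> ip (a k) x = 0
    & forall l, (l < m)%N -> ip (b l) x = 0].
Proof.
move=> aP dm; pose M : 'M[K]_(m.+1, m) := \matrix_(i, l) ip (b l) (a i).
have kerM : kermx M != 0.
  by rewrite kermx_eq0 /row_free neq_ltn ltnS rank_leq_col.
have /rowV0Pn[v /sub_kermxP vM v0] := kerM.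
pose c k : K := v 0 (inord k).
exists (\sum_(k <- index_iota 0 m.+1 | in_dim d k) c k *: a k); split.
- apply: contra v0 => /eqP x0; apply/eqP/rowP => i; rewrite mxE.
  have im : (i <= m)%N by rewrite -ltnS.
  have := ip_basis_sum ipP aP c (iota_uniq 0 (m.+1 - 0)) (fun k => id)
            (in_dim_leq im dm).
  rewrite -/(index_iota 0 m.+1) x0 (ip0r ipP) mem_index_iota /= ltnS im.
  by rewrite (in_dim_leq im dm) /c inord_val => ->.
- move=> k dk mk; rewrite (ip_basis_sum ipP aP) ?iota_uniq // mem_index_iota /=.
  by rewrite ltnS leqNgt mk.
- move=> l lm; have := congr1 (fun A : 'rV_m => A 0 (Ordinal lm)) vM.
  rewrite !mxE => <-; rewrite (ip_sumr ipP) big_mkord.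
  rewrite (eq_bigl xpredT); last first.
    by move=> i /=; apply: in_dim_leq dm; rewrite -ltnS.
  by apply: eq_bigr => i _; rewrite mxE (ipZr ipP) /c inord_val.
Qed.

(** The partial sums with coefficients [t - a k] converge to [t x - A x] by [spectral_sum] itself,
    so [A] need not be rewritten as a [diag]. Only indices in the support of [x] matter. *)
Lemma rayleigh_le (A : H -> H) (a : nat -> R) (u : nat -> H) (x : H) (t : R) :
  orthonormal_basis ip d u -> spectral_sum ip d A a u ->
  (forall k, in_dim d k -> ip (u k) x != 0 -> a k <= t) ->
  rip ip x (A x) <= t * rnorm x ^+ 2.
Proof.
move=> uP /(_ x) Ax at_.
rewrite -subr_ge0 -(ripxx ipP) -(ripZr ipP) -(ripBr ipP) -(diag_cst ipP uP).
have tx := @diag_cvg _ _ _ _ ipP _ _ uP _ x (bdd_cst d t).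
apply: (@rip_lim_psum_ge0 _ _ _ _ ipP d u (fun k => t - a k)); last first.
  by move=> k dk /at_; rewrite subr_ge0; apply.
have -> : psum ip d u (fun k => t - a k) x = (fun n => psum ip d u (fun=> t) x n
    - \sum_(0 <= k < n | in_dim d k) sreal s (a k) *: eigenproj ip u k x).
  apply/funext => n; rewrite /psum -sumrB; apply: eq_bigr => k dk.
  by rewrite -scalerBl -rmorphB.
exact: cvgB.
Qed.

Lemma rayleigh_ge (A : H -> H) (a : nat -> R) (u : nat -> H) (x : H) (t : R) :
  orthonormal_basis ip d u -> spectral_sum ip d A a u ->
  (forall k, in_dim d k -> ip (u k) x != 0 -> t <= a k) ->
  t * rnorm x ^+ 2 <= rip ip x (A x).
Proof.
move=> uP uA ta; rewrite -lerN2 -(ripNr ipP) -mulNr.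
apply: (@rayleigh_le (fun x => - A x) (fun k => - a k) u) => [//|y|k dk nz].
  have -> : (fun n => \sum_(0 <= k < n | in_dim d k) sreal s (- a k) *: eigenproj ip u k y)
      = (fun n => - \sum_(0 <= k < n | in_dim d k) sreal s (a k) *: eigenproj ip u k y).
    apply/funext => n; rewrite -sumrN; apply: eq_bigr => k _.
    by rewrite rmorphN scaleNr.
  exact: cvgN (uA y).
by rewrite lerN2 ta.
Qed.

Lemma nonincreasing_leq (a : nat -> R) k l : nonincreasing_eigenvalues d a ->
  (k <= l)%N -> in_dim d l -> a l <= a k.
Proof.
move=> a_mono /subnK <-; elim: (l - k)%N => [//|n IH] dn.
apply: le_trans (a_mono _ dn) _; apply: IH; exact: in_dim_leq dn.
Qed.

Variables (A : H -> H) (a : nat -> R) (u v : nat -> H).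
Hypotheses (uP : orthonormal_basis ip d u) (vP : orthonormal_basis ip d v).
Hypotheses (a_mono : nonincreasing_eigenvalues d a) (vA : spectral_sum ip d A a v).

(** Courant-Fischer with [u] as a reference basis and [v] as the eigenbasis: a vector in the span of
    [u 0, ..., u m] orthogonal to [v 0, ..., v (m - 1)] has Rayleigh quotient at most [a m]. *)
Lemma minmax_ge m t : in_dim d m ->
  (forall x, (forall k, in_dim d k -> (m < k)%N -> ip (u k) x = 0) ->
     t * rnorm x ^+ 2 <= rip ip x (A x)) -> t <= a m.
Proof.
move=> dm tA; have [x [x0 /tA tx xv]] := exists_orthogonal v uP dm.
have nx : 0 < rnorm x ^+ 2 by rewrite exprn_gt0 // lt_def rnorm_eq0 x0 rnorm_ge0.
rewrite -(ler_pM2r nx); apply: le_trans tx _.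
apply: rayleigh_le vP vA _ => k dk; have [km|mk _] := ltnP k m.
  by rewrite xv ?eqxx.
exact: nonincreasing_leq.
Qed.

(** The test vector now lies in the span of [v 0, ..., v m] and is orthogonal to the first [m]
    vectors of [u]. *)
Lemma minmax_le m t : in_dim d m ->
  (forall x, (forall k, (k < m)%N -> ip (u k) x = 0) ->
     rip ip x (A x) <= t * rnorm x ^+ 2) -> a m <= t.
Proof.
move=> dm tA; have [x [x0 xv /tA tx]] := exists_orthogonal u vP dm.
have nx : 0 < rnorm x ^+ 2 by rewrite exprn_gt0 // lt_def rnorm_eq0 x0 rnorm_ge0.
rewrite -(ler_pM2r nx); apply: le_trans _ tx.
apply: rayleigh_ge vP vA _ => k dk; have [mk|km _] := ltnP m k.
  by rewrite xv ?eqxx.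
exact: nonincreasing_leq.
Qed.

End MinMax.
(** * Operator and Hilbert-Schmidt norms *)

Section Norms.
Variables (R : realType) (s : scalar_kind).
Local Notation K := (sfield R s).
Variables (H : completeNormedModType K) (ip : H -> H -> K).
Hypothesis ipP : inner_product ip.
Variables (d : option nat) (u : nat -> H).
Hypothesis uP : orthonormal_basis ip d u.

Lemma opnorm_ge0 (A : H -> H) : (0 <= opnorm A)%E.
Proof.
apply: (@le_trans _ _ (rnorm (A 0))%:E); first by rewrite lee_fin rnorm_ge0.
by apply: ereal_sup_ubound; exists 0 => //=; rewrite normr0.
Qed.

Lemma opnorm_le (A : H -> H) M : 0 <= M ->
  (forall x, rnorm (A x) <= M * rnorm x) -> (opnorm A <= M%:E)%E.
Proof.
move=> M0 AM; apply: ge_ereal_sup => _ [x /= x1 <-]; rewrite lee_fin.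
apply: le_trans (AM x) _; rewrite ler_piMr //.
by rewrite -(ler_sreal s) -normE (rmorph1 (@sreal R s)).
Qed.

Lemma le_opnorm (A : H -> H) M : (opnorm A <= M%:E)%E ->
  (forall (a : R) x, A (sreal s a *: x) = sreal s a *: A x) ->
  forall x, rnorm (A x) <= M * rnorm x.
Proof.
move=> AM Alin x; have [->|x0] := eqVneq x 0.
  have := Alin 0 0; rewrite rmorph0 !scale0r => ->.
  by rewrite rnorm0 mulr0.
have nx : 0 < rnorm x by rewrite lt_def rnorm_eq0 x0 rnorm_ge0.
rewrite -ler_pdivrMr // mulrC -(@ger0_norm _ (rnorm x)^-1) ?invr_ge0 ?rnorm_ge0 //.
rewrite -rnormZ_real -Alin -lee_fin; apply: le_trans _ AM.
apply: ereal_sup_ubound; exists (sreal s (rnorm x)^-1 *: x) => //=.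
rewrite normE rnormZ_real ger0_norm ?invr_ge0 ?rnorm_ge0 //.
by rewrite mulVf ?gt_eqF // (rmorph1 (@sreal R s)).
Qed.

Lemma hsnorm_le (A : H -> H) M : 0 <= M ->
  (forall n, \sum_(0 <= k < n | in_dim d k) rnorm (A (u k)) ^+ 2 <= M ^+ 2) ->
  (hsnorm d u A <= M%:E)%E.
Proof.
move=> M0 AM; rewrite /hsnorm -(ger0_norm M0) -sqrtr_sqr.
rewrite -[leRHS]/(sqrte (M ^+ 2)%:E) lee_sqrt ?lee_fin ?sqr_ge0 //.
apply: lime_le; first by apply: is_cvg_nneseries => k _ _; rewrite lee_fin sqr_ge0.
by apply: nearW => n; rewrite sumEFin lee_fin.
Qed.

Lemma hsnorm_ge_term (A : H -> H) j : in_dim d j ->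
  ((rnorm (A (u j)))%:E <= hsnorm d u A)%E.
Proof.
move=> dj; rewrite -(ger0_norm (rnorm_ge0 (A (u j)))) -sqrtr_sqr.
rewrite -[leLHS]/(sqrte (rnorm (A (u j)) ^+ 2)%:E).
have h0 k : (0 <= k)%N -> in_dim d k -> (0 <= (rnorm (A (u k)) ^+ 2)%:E)%E.
  by move=> _ _; rewrite lee_fin sqr_ge0.
rewrite lee_sqrt; last exact: nneseries_ge0.
apply: le_trans (nneseries_lim_ge j.+1 h0).
rewrite sumEFin lee_fin big_mkcond /= big_nat_recr //= dj lerDr.
by apply: sumr_ge0 => k _; case: ifP => // _; rewrite sqr_ge0.
Qed.

(** Half of Parseval's identity, meant for maps sending x to <y, x> e with a unit vector e. *)
Lemma hsnorm_ge_coord (A : H -> H) (y : H) :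
  (forall k, in_dim d k -> rnorm (A (u k)) = snorm (ip (u k) y)) ->
  ((rnorm y)%:E <= hsnorm d u A)%E.
Proof.
move=> Ay; have [->|y0] := eqVneq y 0.
  by rewrite rnorm0 sqrte_ge0.
have ny : 0 < rnorm y ^+ 2 by rewrite exprn_gt0 // lt_def rnorm_eq0 y0 rnorm_ge0.
rewrite -(ger0_norm (rnorm_ge0 y)) -sqrtr_sqr -[leLHS]/(sqrte (rnorm y ^+ 2)%:E).
have h0 k : (0 <= k)%N -> in_dim d k -> (0 <= (rnorm (A (u k)) ^+ 2)%:E)%E.
  by move=> _ _; rewrite lee_fin sqr_ge0.
rewrite lee_sqrt; last exact: nneseries_ge0.
have psum_le n := nneseries_lim_ge n h0.
set S := (X in (_ <= X)%E); rewrite -/S in psum_le *.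
case: S psum_le => [x||] psum_le; last 2 first.
- by rewrite leey.
- by have := psum_le 0; rewrite big_nil leeNy_eq.
rewrite lee_fin -(ripxx ipP).
have yc : (psum ip d u (fun=> 1) y @ \oo --> y)%classic.
  have := @diag_cvg _ _ _ _ ipP _ _ uP _ y (bdd_cst d 1).
  by rewrite (diag1 ipP uP).
(* This multiple of [y] is chosen with [rip ip y z = x], so that a bound of the partial sums by [x]
   becomes the sign of an inner product and passes to the limit. *)
pose z := sreal s (x / rnorm y ^+ 2) *: y.
have zx : rip ip y z = x by rewrite (ripZr ipP) (ripxx ipP) divfK // gt_eqF.
have zc : ((fun n => z - psum ip d u (fun=> 1) y n) @ \oo --> z - y)%classic.
  by apply: cvgB yc; exact: cvg_cst.
have := rip_lim_ge0 (z := y) ipP zc.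
rewrite (ripBr ipP) zx subr_ge0; apply => n.
rewrite (ripBr ipP) zx subr_ge0 (rip_psum ipP).
rewrite -lee_fin; apply: le_trans (psum_le n); rewrite sumEFin lee_fin.
by apply: ler_sum => k dk; rewrite mul1r Ay.
Qed.

(** For rank one the Hilbert-Schmidt norm is the operator norm: the vector with coordinates conj
    f(u_k) has squared norm [S] and image [S e], so the operator bound on it reads S |e| <= M sqrt
    S. *)
Lemma rank_one_hs (T : H -> H) (f : H -> K) (e : H) (M : R) n : 0 <= M ->
  (forall k x y, T (k *: x + y) = k *: T x + T y) -> (forall x, T x = f x *: e) ->
  (forall x, rnorm (T x) <= M * rnorm x) ->
  \sum_(0 <= k < n | in_dim d k) rnorm (T (u k)) ^+ 2 <= M ^+ 2.
Proof.
move=> M0 Tlin Tf TM.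
pose x := \sum_(0 <= k < n | in_dim d k) sconj (f (u k)) *: u k.
pose S := \sum_(0 <= k < n | in_dim d k) snorm (f (u k)) ^+ 2.
have S0 : 0 <= S by apply: sumr_ge0 => k _; rewrite sqr_ge0.
have nx : rnorm x ^+ 2 = S.
  rewrite (pythagoras ipP uP) ?iota_uniq //.
  by apply: eq_bigr => k _; rewrite snorm_conj.
have T0 : T 0 = 0.
  by apply: (addIr (T 0)); rewrite add0r -{1}(scale1r (T 0)) -Tlin scale1r add0r.
have TD y z : T (y + z) = T y + T z by rewrite -{1}(scale1r y) Tlin scale1r.
have TZ k y : T (k *: y) = k *: T y by rewrite -{1}(addr0 (k *: y)) Tlin T0 addr0.
have Tx : T x = sreal s S *: e.
  rewrite (big_morph T TD T0) rmorph_sum scaler_suml; apply: eq_bigr => k _.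
  by rewrite TZ Tf scalerA mulrC mul_sconjE.
rewrite (eq_bigr (fun k => rnorm e ^+ 2 * snorm (f (u k)) ^+ 2)); last first.
  by move=> k _; rewrite Tf rnormZ exprMn mulrC.
rewrite -mulr_sumr -/S.
have := TM x; rewrite Tx rnormZ_real ger0_norm // => h.
have [->|Sn0] := eqVneq S 0; first by rewrite mulr0 sqr_ge0.
have Sp : 0 < S by rewrite lt_def Sn0.
rewrite -(ler_pM2l Sp).
have -> : S * (rnorm e ^+ 2 * S) = (S * rnorm e) ^+ 2 by ring.
have -> : S * M ^+ 2 = (M * rnorm x) ^+ 2 by rewrite exprMn nx mulrC.
by rewrite ler_pXn2r // ?nnegrE ?mulr_ge0 ?rnorm_ge0.
Qed.

Lemma minkowski2 (a b a' b' : R) :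
  Num.sqrt ((a + b) ^+ 2 + (a' + b') ^+ 2)
    <= Num.sqrt (a ^+ 2 + a' ^+ 2) + Num.sqrt (b ^+ 2 + b' ^+ 2).
Proof.
set p := Num.sqrt (a ^+ 2 + _); set q := Num.sqrt (b ^+ 2 + _).
have p2 : p ^+ 2 = a ^+ 2 + a' ^+ 2 by rewrite sqr_sqrtr // addr_ge0 ?sqr_ge0.
have q2 : q ^+ 2 = b ^+ 2 + b' ^+ 2 by rewrite sqr_sqrtr // addr_ge0 ?sqr_ge0.
have p0 : 0 <= p by rewrite sqrtr_ge0.
have q0 : 0 <= q by rewrite sqrtr_ge0.
rewrite -(ger0_norm (addr_ge0 p0 q0)) -sqrtr_sqr ler_wsqrtr //.
have -> : (p + q) ^+ 2 = p ^+ 2 + 2 * (p * q) + q ^+ 2 by ring.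
suff : a * b + a' * b' <= p * q by rewrite p2 q2; nra.
apply: le_trans (ler_norm _) _.
rewrite -(@ler_pXn2r _ 2) ?nnegrE ?mulr_ge0 // real_normK ?num_real //.
rewrite exprMn p2 q2 -subr_ge0.
have -> : (a ^+ 2 + a' ^+ 2) * (b ^+ 2 + b' ^+ 2) - (a * b + a' * b') ^+ 2
  = (a * b' - a' * b) ^+ 2 by ring.
exact: sqr_ge0.
Qed.

(** Cut to [n] basis vectors, this is a finite real number for every map. The triangle inequality is
    proved here and reaches [hsnorm] only through bounds uniform in [n]. *)
Definition hs_part n (A : H -> H) : R :=
  Num.sqrt (\sum_(0 <= k < n | in_dim d k) rnorm (A (u k)) ^+ 2).

Lemma hs_partD n (A B : H -> H) :
  hs_part n (fun x => A x + B x) <= hs_part n A + hs_part n B.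
Proof.
rewrite /hs_part; elim: n => [|n IH]; first by rewrite !big_geq // sqrtr0 addr0.
have recr (F : nat -> R) : \sum_(0 <= k < n.+1 | in_dim d k) F k =
    \sum_(0 <= k < n | in_dim d k) F k + (if in_dim d n then F n else 0).
  by rewrite big_mkcond big_nat_recr //= -big_mkcond.
rewrite !recr; case: ifP => dn; last by rewrite !addr0.
set a := \sum_(_ <= _ < _ | _) _ in IH *; set b := \sum_(_ <= _ < _ | _) _ in IH *.
set c := \sum_(_ <= _ < _ | _) _ in IH *.
have a0 : 0 <= a by apply: sumr_ge0 => k _; rewrite sqr_ge0.
have b0 : 0 <= b by apply: sumr_ge0 => k _; rewrite sqr_ge0.
have c0 : 0 <= c by apply: sumr_ge0 => k _; rewrite sqr_ge0.
rewrite -(sqr_sqrtr a0) -(sqr_sqrtr b0) -(sqr_sqrtr c0).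
apply: le_trans (minkowski2 _ _ _ _); apply: ler_wsqrtr; apply: lerD.
  by rewrite ler_pXn2r ?nnegrE ?addr_ge0 ?sqrtr_ge0.
by rewrite ler_pXn2r ?nnegrE ?addr_ge0 ?rnorm_ge0 // rnormD.
Qed.

Lemma hs_part_sum n (I : Type) (r : seq I) (p : pred I) (F : I -> H -> H) :
  hs_part n (fun x => \sum_(i <- r | p i) F i x) <= \sum_(i <- r | p i) hs_part n (F i).
Proof.
elim: r => [|i r IH].
  rewrite big_nil /hs_part big1 ?sqrtr0 // => k _.
  by rewrite big_nil rnorm0 expr0n.
rewrite big_cons; case: ifP => pi.
  apply: le_trans _ (lerD (lexx _) IH); apply: le_trans _ (hs_partD _ _ _).
  rewrite le_eqVlt; apply/orP; left; apply/eqP; congr Num.sqrt.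
  by apply: eq_bigr => k _; rewrite big_cons pi.
apply: le_trans IH; rewrite le_eqVlt; apply/orP; left; apply/eqP; congr Num.sqrt.
by apply: eq_bigr => k _; rewrite big_cons pi.
Qed.

Lemma hs_part_le n (A : H -> H) M : 0 <= M ->
  \sum_(0 <= k < n | in_dim d k) rnorm (A (u k)) ^+ 2 <= M ^+ 2 -> hs_part n A <= M.
Proof. by move=> M0 h; rewrite -(ger0_norm M0) -sqrtr_sqr ler_wsqrtr. Qed.

(** Crude in [n] (sqrt n would do), which is harmless: it serves for an error that tends to 0 with
    [n] fixed. *)
Lemma hs_part_le_bound n (A : H -> H) M : 0 <= M ->
  (forall x, rnorm (A x) <= M * rnorm x) -> hs_part n A <= n%:R * M.
Proof.
move=> M0 AM; have nM : 0 <= n%:R * M by rewrite mulr_ge0.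
apply: hs_part_le => //.
apply: (@le_trans _ _ (\sum_(0 <= k < n) M ^+ 2)).
  rewrite big_mkcond; apply: ler_sum => k _; case: ifP => dk; last exact: sqr_ge0.
  rewrite ler_pXn2r ?nnegrE ?rnorm_ge0 //.
  by have := AM (u k); rewrite (rnorm_basis ipP uP) // mulr1.
rewrite sumr_const_nat subn0 exprMn -[leLHS]mulr_natl ler_wpM2r ?sqr_ge0 //.
by rewrite expr2 -natrM ler_nat; case: n {nM} => // n; rewrite leq_pmull.
Qed.

End Norms.
(** * Sums over words *)

Section TupleSums.
Variable V : zmodType.

Definition nsum (L m : nat) (F : seq nat -> V) : V :=
  \sum_(t : m.-tuple 'I_L.+1) F (map val t).

Lemma eq_nsum L m (F G : seq nat -> V) :
  (forall t, size t = m -> F t = G t) -> nsum L m F = nsum L m G.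
Proof. by move=> FG; apply: eq_bigr => t _; rewrite FG // size_map size_tuple. Qed.

Lemma nsum0 L F : nsum L 0 F = F [::].
Proof.
rewrite /nsum (big_pred1 [tuple]) // => t; apply/esym/eqP; exact: tuple0.
Qed.

Lemma nsumS L m F :
  nsum L m.+1 F = \sum_(l < L.+1) nsum L m (fun t => F (val l :: t)).
Proof.
rewrite /nsum pair_bigA /=.
rewrite (reindex (fun p : 'I_L.+1 * m.-tuple 'I_L.+1 => [tuple of p.1 :: p.2])) //=.
exists (fun t : m.+1.-tuple 'I_L.+1 => (thead t, [tuple of behead t])).
  by move=> [a t] _ /=; rewrite theadE; congr pair; apply/val_inj.
by move=> t _; apply/val_inj => /=; rewrite [t in RHS]tuple_eta.
Qed.

(** A letter above [n] already makes the sum of the word exceed [n]. *)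
Lemma nsum_trunc n L m F : (n <= L)%N ->
  (forall t, (n < sumn t)%N -> F t = 0) -> nsum L m F = nsum n m F.
Proof.
move=> nL; elim: m F => [|m IH] F F0; first by rewrite !nsum0.
rewrite !nsumS.
have E l : nsum L m (fun t => F (l :: t)) = nsum n m (fun t => F (l :: t)).
  apply: IH => t nt; apply: F0 => /=; exact: leq_trans (leq_addl _ _).
under eq_bigr do rewrite E.
rewrite -(big_mkord xpredT (fun l => nsum n m (fun t => F (l :: t)))).
rewrite (@big_cat_nat _ _ _ n.+1) //= big_mkord.
rewrite [X in _ + X]big_nat_cond [X in _ + X]big1 ?addr0 //.
move=> l /andP[/andP[nl _] _]; rewrite /nsum big1 // => t _.
by apply: F0 => /=; exact: leq_trans (leq_addr _ _).
Qed.

(** The first letter of a composition of [n] is determined by the others. This gives the terms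
    P_j^(n) the same index set as the words of length [n] that follow the perturbed factor. *)
Lemma nsum_compositions n L F : (n <= L)%N ->
  nsum n n.+1 (fun t => if sumn t == n then F t else 0) =
  nsum L n (fun t => if (sumn t <= n)%N then F ((n - sumn t)%N :: t) else 0).
Proof.
move=> nL; rewrite (nsum_trunc _ nL); last by move=> t; rewrite ltnNge => /negPf ->.
rewrite nsumS exchange_big; apply: eq_bigr => t _ /=.
set S := sumn _; case: leqP => [Sn|nS]; last first.
  by rewrite big1 // => l _; rewrite gtn_eqF // (leq_trans nS) ?leq_addl.
have nSn : (n - S < n.+1)%N by rewrite ltnS leq_subr.
rewrite (bigD1 (Ordinal nSn)) //= subnK // eqxx big1 ?addr0 // => l ln.
case: eqP => // lS; case/eqP: ln; apply/val_inj => /=.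
by move: lS; clear; lia.
Qed.

End TupleSums.

Lemma geometric_half (R : realFieldType) n :
  \sum_(l < n) (2^-1 : R) ^+ l <= 2.
Proof.
suff -> : \sum_(l < n) (2^-1 : R) ^+ l = 2 - 2 * 2^-1 ^+ n.
  by rewrite gerBl mulr_ge0 ?exprn_ge0 ?invr_ge0.
elim: n => [|n IH]; first by rewrite big_ord0 expr0 mulr1 subrr.
by rewrite big_ord_recr /= IH exprS; field.
Qed.

(** A product of [m] geometric sums of ratio 1/2, each at most 2, uniformly in the cut-off [L]. *)
Lemma nsum_geometric (R : realFieldType) L m :
  nsum L m (fun t => (2^-1 : R) ^+ sumn t) <= 2 ^+ m.
Proof.
elim: m => [|m IH]; first by rewrite nsum0.
rewrite nsumS; apply: (@le_trans _ _ (\sum_(l < L.+1) (2^-1 : R) ^+ l * 2 ^+ m)).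
  apply: ler_sum => l _; rewrite /nsum.
  under eq_bigr do rewrite /= exprD.
  by rewrite -mulr_sumr ler_wpM2l // exprn_ge0 // invr_ge0.
by rewrite -mulr_suml exprS ler_wpM2r ?exprn_ge0 // geometric_half.
Qed.
(** * Perturbation of an isolated simple eigenvalue *)

Section Perturbation.
Variables (R : realType) (s : scalar_kind).
Local Notation K := (sfield R s).
Variables (H : completeNormedModType K) (ip : H -> H -> K).
Hypothesis ipP : inner_product ip.
Variable d : option nat.
Variables (Sigma Sigmah : {linear H -> H}) (lam lamh : nat -> R) (u uh : nat -> H).
Hypotheses (Sigma_sa : self_adjoint ip Sigma) (Sigmah_sa : self_adjoint ip Sigmah).
Hypothesis Sigma_pos : d = None -> positive_op ip Sigma.
Hypotheses (uP : orthonormal_basis ip d u) (uhP : orthonormal_basis ip d uh).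
Hypotheses (lam_mono : nonincreasing_eigenvalues d lam)
           (lamh_mono : nonincreasing_eigenvalues d lamh).
Hypotheses (Sigma_dec : spectral_sum ip d Sigma lam u)
           (Sigmah_dec : spectral_sum ip d Sigmah lamh uh).
Variable j : nat.
Hypothesis j_dim : in_dim d j.
Local Notation g := (spectral_gap d lam j).
Hypothesis g_gt0 : 0 < g.

Local Notation dg := (diag ip d u).
Local Notation dgh := (diag ip d uh).
Local Notation "''|' x |" := (rnorm x) (at level 0, x at level 99, format "''|' x |").

(* [dg st] is |R_j|^{1/2}, [dg wt] is |R_j|^{1/2} + g_j^{-1/2} P_j with inverse
   [dg winv], [dg pt] is g_j^{-1/2} P_j, and [dg proj], [dgh proj] are P_j and its
   perturbed version. *)
Definition pert (x : H) : H := Sigmah x - Sigma x.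
Local Notation E := pert.

Definition nu k := lam k - lam j.
(** The diagonal of W^-2: the zero of [|nu|] at [j] is replaced by [g], which makes W invertible. *)
Definition om k := if k == j then g else `|nu k|.
Definition winv k := Num.sqrt (om k).
Definition wt k := (winv k)^-1.
Definition proj k : R := (k == j)%:R.
Definition coproj k : R := (k != j)%:R.
Definition st k := coproj k * wt k.
Definition pt k := proj k * wt k.

Lemma gap_lt k : in_dim d k -> (k < j)%N -> g <= nu k.
Proof.
rewrite /nu /spectral_gap; case: j j_dim => // i di dk; rewrite ltnS => ki.
have := nonincreasing_leq lam_mono ki (in_dim_leq (leqnSn i) di).
by case: ifP => _ h; rewrite ?ge_min; lra.
Qed.

Lemma gap_gt k : in_dim d k -> (j < k)%N -> nu k <= - g.
Proof.
move=> dk jk; have := nonincreasing_leq lam_mono jk dk.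
rewrite /nu /spectral_gap; case: j j_dim jk => [|i] di jk; first by lra.
rewrite (in_dim_leq jk dk); set m := Num.min _ _ => h.
suff : m <= lam i.+1 - lam i.+2 by lra.
by rewrite /m ge_min lexx orbT.
Qed.

Lemma gap_norm k : in_dim d k -> k != j -> g <= `|nu k|.
Proof.
move=> dk; rewrite neq_ltn => /orP[kj|jk].
  by rewrite ger0_norm; have := gap_lt dk kj; move: g_gt0; lra.
by rewrite ler0_norm; have := gap_gt dk jk; move: g_gt0; lra.
Qed.

Lemma om_ge k : in_dim d k -> g <= om k.
Proof. by rewrite /om; case: eqP => // /eqP kj dk; exact: gap_norm. Qed.

Lemma om_gt0 k : in_dim d k -> 0 < om k.
Proof. by move=> dk; exact: lt_le_trans (om_ge dk). Qed.

Lemma winv_gt0 k : in_dim d k -> 0 < winv k.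
Proof. by move=> dk; rewrite sqrtr_gt0 om_gt0. Qed.

Lemma winv_sqr k : in_dim d k -> winv k ^+ 2 = om k.
Proof. by move=> dk; rewrite sqr_sqrtr // ltW // om_gt0. Qed.

Lemma winv_j : winv j = Num.sqrt g.
Proof. by rewrite /winv /om eqxx. Qed.

Lemma sqrtg_gt0 : 0 < Num.sqrt g.
Proof. by rewrite sqrtr_gt0. Qed.

Lemma sqrtg_sqr : Num.sqrt g ^+ 2 = g.
Proof. by rewrite sqr_sqrtr // ltW. Qed.

Lemma norm_wt_le k : in_dim d k -> `|wt k| <= (Num.sqrt g)^-1.
Proof.
move=> dk; have w0 := winv_gt0 dk; rewrite ger0_norm ?invr_ge0 ?(ltW w0) //.
by rewrite /wt ler_pV2 ?inE ?unitf_gt0 ?winv_gt0 ?sqrtg_gt0 // ler_wsqrtr // om_ge.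
Qed.

Lemma norm_proj_le k : `|proj k| <= 1.
Proof. by rewrite /proj; case: eqP; rewrite ?normr1 ?normr0. Qed.

Lemma norm_coproj_le k : `|coproj k| <= 1.
Proof. by rewrite /coproj; case: eqP; rewrite ?normr1 ?normr0. Qed.

(** In infinite dimension positivity bounds the eigenvalues below by 0 and monotonicity bounds them
    above by [lam 0]; in finite dimension there are finitely many. *)
Lemma bdd_eigenvalues : bdd d lam.
Proof.
case: d Sigma_pos uP lam_mono Sigma_dec => [n _ _ _ _|/(_ erefl) pos uP' mono dec].
  exists (\sum_(k < n) `|lam k|) => k /= kn.
  by rewrite (bigD1 (Ordinal kn)) //= lerDl sumr_ge0.
have lam0 k : 0 <= lam k.
  have := sRe_ge0 (pos (u k)).
  rewrite (coord_psum_lim ipP uP' (dec (u k))) // sRe_srealM.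
  by rewrite (ipxx ipP) sRe_sreal (rnorm_basis ipP uP') // expr1n mulr1.
exists (lam 0) => k _; rewrite ger0_norm //.
exact: nonincreasing_leq mono _ _.
Qed.

Lemma bdd_nu : bdd d nu.
Proof. exact: bddD bdd_eigenvalues (bdd_cst d _). Qed.

Lemma bdd_om : bdd d om.
Proof.
have [M nuM] := bdd_nu; exists (g + `|M|) => k dk; rewrite /om.
case: eqP => _; first by rewrite ger0_norm ?(ltW g_gt0) // lerDl.
rewrite normr_id; apply: le_trans (nuM k dk) _; apply: le_trans (ler_norm M) _.
by rewrite lerDr ltW.
Qed.

Lemma bdd_winv : bdd d winv.
Proof.
have [M omM] := bdd_om; exists (Num.sqrt M) => k dk.
rewrite ger0_norm ?sqrtr_ge0 // ler_wsqrtr //.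
exact: le_trans (ler_norm _) (omM k dk).
Qed.

Lemma bdd_wt : bdd d wt.
Proof. by exists (Num.sqrt g)^-1; exact: norm_wt_le. Qed.

Lemma bdd_proj : bdd d proj.
Proof. by exists 1 => k _; exact: norm_proj_le. Qed.

Lemma bdd_coproj : bdd d coproj.
Proof. by exists 1 => k _; exact: norm_coproj_le. Qed.

Lemma bdd_st : bdd d st.
Proof. exact: bddM bdd_coproj bdd_wt. Qed.

Lemma bdd_pt : bdd d pt.
Proof. exact: bddM bdd_proj bdd_wt. Qed.

Hint Resolve bdd_nu bdd_om bdd_winv bdd_wt bdd_proj bdd_coproj bdd_st bdd_pt
  bdd_cst bdd_eigenvalues : bdd.

Lemma SigmaE x : Sigma x = dg lam x.
Proof. by apply: (psum_lim_diag ipP uP bdd_eigenvalues); exact: Sigma_dec. Qed.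

Lemma Sigma_nuE x : Sigma x = dg nu x + sreal s (lam j) *: x.
Proof.
rewrite SigmaE -(diag_cst ipP uP) -(diag_add ipP uP); auto with bdd.
by apply: eq_diag => k _; rewrite subrK.
Qed.

Lemma pert_linear k x y : E (k *: x + y) = k *: E x + E y.
Proof. by rewrite /pert (linearP Sigmah) (linearP Sigma) scalerBr opprD addrACA. Qed.

Lemma pertD x y : E (x + y) = E x + E y.
Proof. by rewrite -{1}(scale1r x) pert_linear scale1r. Qed.

Lemma pert0 : E 0 = 0.
Proof. by rewrite /pert (linear0 Sigmah) (linear0 Sigma) subrr. Qed.

Lemma pertZ k x : E (k *: x) = k *: E x.
Proof. by rewrite -{1}(addr0 (k *: x)) pert_linear pert0 addr0. Qed.

Lemma pert_sa x y : ip (E x) y = ip x (E y).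
Proof. by rewrite (ipBl ipP) (ipBr ipP) Sigma_sa Sigmah_sa. Qed.

Lemma pert_rsa x y : rip ip (E x) y = rip ip x (E y).
Proof. by rewrite /rip pert_sa. Qed.

Lemma dg_proj x : dg proj x = ip (u j) x *: u j.
Proof. by rewrite -(eigenprojE ipP uP). Qed.

Lemma rnorm_dg_proj x : '|dg proj x| = snorm (ip (u j) x).
Proof. by rewrite dg_proj rnormZ (rnorm_basis ipP uP) // mulr1. Qed.

Lemma dg_pt x : dg pt x = sreal s (Num.sqrt g)^-1 *: dg proj x.
Proof.
rewrite -(diag_scale ipP uP); auto with bdd.
apply: eq_diag => k _; rewrite /pt /wt /proj mulrC.
by case: eqP => [->|_]; rewrite ?winv_j ?mulr0.
Qed.

Lemma dg_split x : dg wt x = dg st x + dg pt x.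
Proof.
rewrite -(diag_add ipP uP); auto with bdd.
apply: eq_diag => k _; rewrite /st /pt /proj /coproj -mulrDl.
by case: eqP; rewrite ?add0r ?addr0 mul1r.
Qed.

Lemma pythagoras_basis (v : nat -> H) x : orthonormal_basis ip d v ->
  '|x| ^+ 2 = '|diag ip d v coproj x| ^+ 2 + '|diag ip d v proj x| ^+ 2.
Proof.
move=> vP; rewrite !(rnorm_diag ipP vP); auto with bdd.
have bp : bdd d (fun k => proj k ^+ 2) by exact: bddM bdd_proj bdd_proj.
have bc : bdd d (fun k => coproj k ^+ 2) by exact: bddM bdd_coproj bdd_coproj.
rewrite -(ripDr ipP) -(diag_add ipP vP) // -(ripxx ipP) -{2}(diag1 ipP vP x).
congr (rip _ _ _); apply: eq_diag => k _; rewrite /proj /coproj.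
by case: eqP; rewrite /= ?expr1n ?expr0n ?add0r ?addr0.
Qed.

Lemma pythagoras_proj x : '|x| ^+ 2 = '|dg coproj x| ^+ 2 + '|dg proj x| ^+ 2.
Proof. exact: pythagoras_basis. Qed.

Lemma rnorm_le_proj x : '|x| <= '|dg coproj x| + '|dg proj x|.
Proof.
rewrite -(@ler_pXn2r _ 2) ?nnegrE ?addr_ge0 ?rnorm_ge0 // pythagoras_proj sqrrD.
by rewrite lerD2r lerDl mulrn_wge0 // mulr_ge0 ?rnorm_ge0.
Qed.

Lemma rnorm_coproj_le x : '|dg coproj x| <= '|x|.
Proof.
rewrite -[leRHS]mul1r; apply: (rnorm_diag_bound ipP uP) => // k _.
exact: norm_coproj_le.
Qed.

Lemma rnorm_proj_le x : '|dg proj x| <= '|x|.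
Proof.
rewrite -[leRHS]mul1r; apply: (rnorm_diag_bound ipP uP) => // k _.
exact: norm_proj_le.
Qed.

Lemma dg_coproj_wt x : dg coproj (dg wt x) = dg st x.
Proof. by rewrite (diag_comp ipP uP); auto with bdd. Qed.

Lemma dg_proj_wt x : dg proj (dg wt x) = dg pt x.
Proof. by rewrite (diag_comp ipP uP); auto with bdd. Qed.

Lemma dg_st_coproj x : dg st (dg coproj x) = dg st x.
Proof.
rewrite (diag_comp ipP uP); auto with bdd; apply: eq_diag => k _.
by rewrite /st /coproj; case: eqP => _; rewrite ?mulr1 ?mulr0 ?mul0r.
Qed.


Lemma dg_wtK x : dg wt (dg winv x) = x.
Proof.
rewrite (diag_comp ipP uP); auto with bdd; rewrite -[RHS](diag1 ipP uP).
by apply: eq_diag => k dk; rewrite /wt mulVf // gt_eqF // winv_gt0.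
Qed.

Lemma rnorm_st_le x : '|dg st x| <= (Num.sqrt g)^-1 * '|x|.
Proof.
apply: (rnorm_diag_bound ipP uP); last by rewrite invr_ge0 sqrtr_ge0.
move=> k dk; rewrite normrM -[leRHS]mul1r.
by rewrite ler_pM ?norm_coproj_le ?norm_wt_le.
Qed.

Lemma rnorm_pt x : '|dg pt x| = (Num.sqrt g)^-1 * '|dg proj x|.
Proof. by rewrite dg_pt rnormZ_real ger0_norm // invr_ge0 sqrtr_ge0. Qed.

Lemma dg_proj_winv x : dg proj (dg winv x) = sreal s (Num.sqrt g) *: dg proj x.
Proof.
rewrite (diag_comp ipP uP); auto with bdd; rewrite -(diag_scale ipP uP); auto with bdd.
apply: eq_diag => k dk; rewrite /proj mulrC.
by case: eqP => [->|_]; rewrite ?winv_j ?mulr0.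
Qed.

Lemma sqrt_abs_resolventE x : sqrt_abs_resolvent ip d lam u j x = dg st x.
Proof.
rewrite /sqrt_abs_resolvent off_diagE; apply: eq_diag => k _.
by rewrite /st /coproj /wt /winv /om /nu; case: eqP; rewrite ?mul0r ?mul1r.
Qed.

Lemma weightE x :
  sqrt_abs_resolvent ip d lam u j x + sreal s (Num.sqrt g)^-1 *: eigenproj ip u j x
  = dg wt x.
Proof. by rewrite sqrt_abs_resolventE dg_split dg_pt (eigenprojE ipP uP). Qed.

(** The norm of the off-diagonal block of W E W, equal to g^{-1/2} ||P_j E S||_2 because that
    operator has rank one. *)
Definition al := (Num.sqrt g)^-1 * '|dg st (E (u j))|.

Lemma delta_le D : (delta ip d lam u E j <= D%:E)%E ->
  forall x, '|dg wt (E (dg wt x))| <= D * '|x|.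
Proof.
have bw := bdd_wt; move=> h x.
have -> : dg wt (E (dg wt x)) = (dg wt \o E \o dg wt) x by [].
apply: le_opnorm => [|a y]; last first.
  by rewrite /= !(diagZ ipP uP) // pertZ (diagZ ipP uP).
move: h; rewrite /delta.
by have -> : (fun x => sqrt_abs_resolvent ip d lam u j x
  + sreal s (Num.sqrt g)^-1 *: eigenproj ip u j x) = dg wt by apply/funext => y; exact: weightE.
Qed.

(** * The blocks of W E W and the comparison of delta' with delta *)

Section DeltaPrime.
Variable D : R.
Hypothesis D_ge0 : 0 <= D.
Hypothesis WEW_D : forall x, '|dg wt (E (dg wt x))| <= D * '|x|.

Lemma dg_wt_proj x : dg wt (dg proj x) = sreal s (Num.sqrt g)^-1 *: dg proj x.
Proof.
rewrite -dg_pt (diag_comp ipP uP); auto with bdd.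
by apply: eq_diag => k _; rewrite mulrC.
Qed.

Lemma dg_projE x : dg proj x = sreal s (Num.sqrt g) *: dg wt (dg proj x).
Proof. by rewrite dg_wt_proj scalerA -rmorphM mulfV ?rmorph1 ?scale1r // gt_eqF // sqrtg_gt0. Qed.

Lemma SES_le_D x : '|dg st (E (dg st x))| <= D * '|x|.
Proof.
have -> : dg st x = dg wt (dg coproj x).
  rewrite (diag_comp ipP uP); auto with bdd; apply: eq_diag => k _.
  by rewrite mulrC.
rewrite -dg_coproj_wt; apply: le_trans (rnorm_coproj_le _) _.
by apply: le_trans (WEW_D _) _; rewrite ler_wpM2l ?rnorm_coproj_le.
Qed.

Lemma SEP_le_D x : '|dg st (E (dg proj x))| <= Num.sqrt g * D * '|x|.
Proof.
rewrite dg_projE pertZ (diagZ ipP uP _ _ bdd_st) rnormZ_real ger0_norm ?sqrtr_ge0 //.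
rewrite -mulrA ler_wpM2l ?sqrtr_ge0 // -dg_coproj_wt.
apply: le_trans (rnorm_coproj_le _) _.
by apply: le_trans (WEW_D _) _; rewrite ler_wpM2l ?rnorm_proj_le.
Qed.

Lemma PEP_le_D x : '|dg proj (E (dg proj x))| <= g * D * '|x|.
Proof.
rewrite (dg_projE x) pertZ (diagZ ipP uP _ _ bdd_proj) rnormZ_real.
rewrite ger0_norm ?sqrtr_ge0 //.
have -> : g * D * '|x| = Num.sqrt g * (Num.sqrt g * (D * '|x|)).
  by rewrite -{1}sqrtg_sqr; ring.
rewrite ler_wpM2l ?sqrtr_ge0 //.
have -> : '|dg proj (E (dg wt (dg proj x)))| =
    Num.sqrt g * '|dg proj (dg wt (E (dg wt (dg proj x))))|.
  by rewrite dg_proj_wt rnorm_pt mulrA mulfV ?mul1r // gt_eqF ?sqrtg_gt0.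
rewrite ler_wpM2l ?sqrtr_ge0 //.
apply: le_trans (rnorm_proj_le _) _.
by apply: le_trans (WEW_D _) _; rewrite ler_wpM2l ?rnorm_proj_le.
Qed.

(** All three quantities are norms of blocks of W E W. The two that contain P_j have rank one, so
    their Hilbert-Schmidt norms obey the operator bound. *)
Lemma delta'_le : (delta' ip d lam u E j <= D%:E)%E.
Proof.
rewrite /delta'.
have -> : sqrt_abs_resolvent ip d lam u j = dg st.
  by apply/funext => x; exact: sqrt_abs_resolventE.
have -> : eigenproj ip u j = dg proj by apply/funext => x; exact: (eigenprojE ipP uP).
have sg := sqrtg_gt0; have bs := bdd_st; have bp := bdd_proj.
rewrite !ge_max; apply/and3P; split.
- by apply: opnorm_le => // x; exact: SES_le_D.
- apply: (@le_trans _ _ (((Num.sqrt g)^-1)%:E * (Num.sqrt g * D)%:E)%E); last first.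
    by rewrite -EFinM mulrA mulVf ?mul1r // gt_eqF.
  rewrite lee_wpmul2l ?lee_fin ?invr_ge0 ?(ltW sg) //.
  apply: hsnorm_le => [|n]; first by rewrite mulr_ge0 // ltW.
  apply: (rank_one_hs ipP uP (f := ip (u j)) (e := dg st (E (u j)))).
  + by rewrite mulr_ge0 // ltW.
  + move=> k x y /=; rewrite (diag_linear ipP uP) // pert_linear.
    by rewrite (diag_linear ipP uP).
  + by move=> x /=; rewrite (dg_proj x) pertZ (diagZ ipP uP).
  + exact: SEP_le_D.
- apply: (@le_trans _ _ ((g^-1)%:E * (g * D)%:E)%E); last first.
    by rewrite -EFinM mulrA mulVf ?mul1r // gt_eqF.
  rewrite lee_wpmul2l ?lee_fin ?invr_ge0 ?(ltW g_gt0) //.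
  apply: hsnorm_le => [|n]; first by rewrite mulr_ge0 // ltW.
  apply: (rank_one_hs ipP uP (f := ip (u j)) (e := dg proj (E (u j)))).
  + by rewrite mulr_ge0 // ltW.
  + move=> k x y /=; rewrite (diag_linear ipP uP) // pert_linear.
    by rewrite (diag_linear ipP uP).
  + by move=> x /=; rewrite (dg_proj x) pertZ (diagZ ipP uP).
  + exact: PEP_le_D.
Qed.

End DeltaPrime.

Lemma dg_proj_u : dg proj (u j) = u j.
Proof. by rewrite (diag_eigen ipP uP bdd_proj j_dim) /proj eqxx rmorph1 scale1r. Qed.

(** As [dg proj] fixes [u j], the term of index [j] in each Hilbert-Schmidt sum is the required
    vector norm. *)
Lemma delta'_bounds D : (delta' ip d lam u E j <= D%:E)%E ->
  [/\ forall x, '|dg st (E (dg st x))| <= D * '|x|, al <= D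
    & '|dg proj (E (u j))| <= g * D].
Proof.
rewrite /delta'.
have -> : sqrt_abs_resolvent ip d lam u j = dg st.
  by apply/funext => x; exact: sqrt_abs_resolventE.
have -> : eigenproj ip u j = dg proj by apply/funext => x; exact: (eigenprojE ipP uP).
have sg := sqrtg_gt0; have bs := bdd_st; have bp := bdd_proj.
rewrite !ge_max => /and3P[h1 h2 h3]; split.
- move=> x; apply: (le_opnorm h1) => a y /=.
  by rewrite !(diagZ ipP uP) // pertZ (diagZ ipP uP).
- rewrite -lee_fin; apply: le_trans h2; rewrite EFinM.
  rewrite lee_wpmul2l ?lee_fin ?invr_ge0 ?(ltW sg) //.
  have := hsnorm_ge_term u (dg st \o E \o dg proj) j_dim.
  by rewrite /= dg_proj_u.
- rewrite -ler_pdivrMl // -lee_fin; apply: le_trans h3; rewrite EFinM.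
  rewrite lee_wpmul2l ?lee_fin ?invr_ge0 ?(ltW g_gt0) //.
  have := hsnorm_ge_term u (dg proj \o E \o dg proj) j_dim.
  by rewrite /= dg_proj_u.
Qed.

(** Self-adjointness moves [E] and S to the other side: |<u_j, E S u_k>| is the modulus of the k-th
    coordinate of S E u_j. *)
Lemma hsnorm_PES_ge : ('|dg st (E (u j))|%:E <=
  hsnorm d u (eigenproj ip u j \o E \o sqrt_abs_resolvent ip d lam u j))%E.
Proof.
apply: (hsnorm_ge_coord ipP uP) => k dk /=.
rewrite (eigenprojE ipP uP) // rnorm_dg_proj -pert_sa sqrt_abs_resolventE.
by rewrite -(diag_sa ipP uP _ _ bdd_st) (ipC ipP (u k)) snorm_conj.
Qed.

Lemma delta'_ge0 : (0 <= delta' ip d lam u E j)%E.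
Proof. by rewrite /delta' le_max opnorm_ge0. Qed.

Variables dl dp : R.
Hypotheses (dl_ge0 : 0 <= dl) (dl_lt : dl < 2^-1).
Hypothesis WEW_le : forall x, '|dg wt (E (dg wt x))| <= dl * '|x|.
Hypothesis SES_le : forall x, '|dg st (E (dg st x))| <= dp * '|x|.
Hypothesis al_le : al <= dp.
Hypothesis PEP_le : '|dg proj (E (u j))| <= g * dp.
Hypothesis dp_le : dp <= dl.

(** * Location of the perturbed eigenvalues *)

Local Notation theta := (lamh j - lam j).
Definition cst := (1 - 2 * dl)^-1.

Lemma al_ge0 : 0 <= al.
Proof. by rewrite mulr_ge0 ?rnorm_ge0 ?invr_ge0 ?sqrtr_ge0. Qed.

Lemma cst_ge1 : 1 <= cst.
Proof. by rewrite invf_ge1 //; move: dl_lt dl_ge0; lra. Qed.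

Lemma cst_inv : (1 - 2 * dl) * cst = 1.
Proof. by rewrite mulfV //; move: dl_lt; lra. Qed.

(** Substituting x = W (W^-1 x) turns the bound on W E W into a bound of the quadratic form of [E]
    by [dl] times that of W^-2. *)
Lemma rip_pert_le x : `|rip ip x (E x)| <= dl * rip ip x (dg om x).
Proof.
have -> : rip ip x (E x) = rip ip (dg winv x) (dg wt (E (dg wt (dg winv x)))).
  by rewrite -(diag_rsa ipP uP) ?dg_wtK //; auto with bdd.
have -> : rip ip x (dg om x) = '|dg winv x| ^+ 2.
  rewrite (rnorm_diag ipP uP); auto with bdd; congr (rip _ _ _).
  by apply: eq_diag => k dk; rewrite winv_sqr.
set y := dg winv x; have yy := ler_wpM2l (rnorm_ge0 y) (WEW_le y).
have -> : dl * '|y| ^+ 2 = '|y| * (dl * '|y|) by ring.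
rewrite ler_norml (le_trans (rip_le ipP _ _) yy) andbT.
by apply: le_trans (rip_ge ipP _ _); rewrite lerN2.
Qed.

Lemma rip_Sigmah x :
  rip ip x (Sigmah x) = rip ip x (dg nu x) + lam j * '|x| ^+ 2 + rip ip x (E x).
Proof.
rewrite -(ripxx ipP) -(ripZr ipP) -!(ripDr ipP) -Sigma_nuE.
by rewrite /pert addrCA subrr addr0.
Qed.

(** As forms, Sigmah - lam_j dominates the diagonal operator with entries [nu k - dl * om k], for
    which a lower bound is checked index by index. *)
Lemma rip_Sigmah_ge x (t : R) :
  (forall k, in_dim d k -> ip (u k) x != 0 -> t <= nu k - dl * om k) ->
  (lam j + t) * '|x| ^+ 2 <= rip ip x (Sigmah x).
Proof.
move=> tx; rewrite rip_Sigmah.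
have bo : bdd d (fun k => - dl * om k) by exact: bddM (bdd_cst _ _) bdd_om.
have bn : bdd d (fun k => nu k + - dl * om k) by exact: bddD bdd_nu bo.
have : 0 <= rip ip x (dg (fun k => (nu k + - dl * om k) + - t) x).
  apply: (diag_ge0 ipP uP); first exact: bddD bn (bdd_cst _ _).
  by move=> k dk /tx - /(_ dk); lra.
rewrite (diag_add ipP uP _ bn (bdd_cst _ _)) (diag_add ipP uP _ bdd_nu bo).
rewrite (diag_scale ipP uP _ _ bdd_om) (diag_cst ipP uP).
rewrite (ripDr ipP _ (_ + _)) (ripDr ipP _ (dg nu x)) !(ripZr ipP) (ripxx ipP).
have := rip_pert_le x; rewrite ler_norml => /andP[].
set X := rip ip x (dg nu x); set Y := rip ip x (dg om x); set Z := rip ip x (E x).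
by nra.
Qed.

Lemma rip_Sigmah_le x (t : R) :
  (forall k, in_dim d k -> ip (u k) x != 0 -> nu k + dl * om k <= t) ->
  rip ip x (Sigmah x) <= (lam j + t) * '|x| ^+ 2.
Proof.
move=> tx; rewrite rip_Sigmah.
have bo : bdd d (fun k => - dl * om k) by exact: bddM (bdd_cst _ _) bdd_om.
have bm : bdd d (fun k => - 1 * nu k) by exact: bddM (bdd_cst _ _) bdd_nu.
have bn : bdd d (fun k => - 1 * nu k + - dl * om k) by exact: bddD bm bo.
have : 0 <= rip ip x (dg (fun k => (- 1 * nu k + - dl * om k) + t) x).
  apply: (diag_ge0 ipP uP); first exact: bddD bn (bdd_cst _ _).
  by move=> k dk /tx - /(_ dk); lra.
rewrite (diag_add ipP uP _ bn (bdd_cst _ _)) (diag_add ipP uP _ bm bo).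
rewrite (diag_scale ipP uP _ _ bdd_om) (diag_scale ipP uP _ _ bdd_nu) (diag_cst ipP uP).
rewrite (ripDr ipP _ (_ + _)) (ripDr ipP _ (_ *: dg nu x)) !(ripZr ipP) (ripxx ipP).
have := rip_pert_le x; rewrite ler_norml => /andP[].
set X := rip ip x (dg nu x); set Y := rip ip x (dg om x); set Z := rip ip x (E x).
by nra.
Qed.

(** On the span of u_0, ..., u_j the least value of [nu - dl * om] is [- dl * g], and on the
    complement of u_0, ..., u_{j-1} the greatest value of [nu + dl * om] is [dl * g]; both occur at
    index [j]. *)
Lemma theta_le : `|theta| <= dl * g.
Proof.
rewrite ler_norml; apply/andP; split.
  suff : lam j + - (dl * g) <= lamh j by lra.
  apply: (minmax_ge ipP uP uhP lamh_mono Sigmah_dec) => // x xj.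
  apply: rip_Sigmah_ge => k dk nz; rewrite /om; case: eqP => [->|/eqP kj].
    by rewrite /nu subrr; lra.
  have {}kj : (k < j)%N by rewrite ltn_neqAle kj leqNgt; apply: contra nz => jk; rewrite xj.
  have := gap_lt dk kj => h; rewrite ger0_norm; move: g_gt0 dl_lt dl_ge0; nra.
suff : lamh j <= lam j + dl * g by lra.
apply: (minmax_le (u := u) ipP uhP lamh_mono Sigmah_dec) => // x xj.
apply: rip_Sigmah_le => k dk nz; rewrite /om; case: eqP => [->|/eqP kj].
  by rewrite /nu subrr; lra.
have {}kj : (j < k)%N.
  by rewrite ltn_neqAle eq_sym kj leqNgt; apply: contra nz => jk; rewrite xj.
have := gap_gt dk kj => h; rewrite ler0_norm; move: g_gt0 dl_lt dl_ge0; nra.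
Qed.

(** The test vectors involve only indices on one side of [j], where [om] is [|nu|] and
    [(1 - dl) * |nu| >= g / 2]. *)
Lemma lamh_sep k : in_dim d k -> k != j -> g / 2 <= `|lamh k - lam j|.
Proof.
move=> dk; rewrite neq_ltn => /orP[kj|jk].
  suff : lam j + g / 2 <= lamh k.
    by move=> h; rewrite ger0_norm; move: g_gt0; lra.
  apply: (minmax_ge ipP uP uhP lamh_mono Sigmah_dec) => // x xj.
  apply: rip_Sigmah_ge => l dl' nz.
  have lk : (l <= k)%N by rewrite leqNgt; apply: contra nz => lk; rewrite xj.
  have lj := leq_ltn_trans lk kj.
  rewrite /om ltn_eqF //; have h := gap_lt dl' lj.
  by rewrite ger0_norm; move: g_gt0 dl_lt dl_ge0; nra.
suff : lamh k <= lam j + - (g / 2).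
  by move=> h; rewrite ler0_norm; move: g_gt0; lra.
apply: (minmax_le (u := u) ipP uhP lamh_mono Sigmah_dec) => // x xj.
apply: rip_Sigmah_le => l dl' nz.
have lk : (k <= l)%N by rewrite leqNgt; apply: contra nz => lk; rewrite xj.
have lj := leq_trans jk lk.
rewrite /om gtn_eqF //; have h := gap_gt dl' lj.
by rewrite ler0_norm; move: g_gt0 dl_lt dl_ge0; nra.
Qed.

Lemma SES_le_coproj y : '|dg st (E (dg st y))| <= dp * '|dg coproj y|.
Proof. by rewrite -(dg_st_coproj y) SES_le. Qed.

Lemma SEP_eq y : '|dg st (E (dg pt y))| = al * '|dg proj y|.
Proof.
rewrite (dg_pt y) pertZ (diagZ ipP uP _ _ bdd_st) rnormZ_real dg_proj pertZ.
rewrite (diagZ ipP uP _ _ bdd_st) !rnormZ (rnorm_basis ipP uP) // mulr1.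
rewrite ger0_norm ?invr_ge0 ?sqrtr_ge0 // /al.
by ring.
Qed.

Lemma PES_le y : '|dg pt (E (dg st y))| <= al * '|y|.
Proof.
rewrite rnorm_pt rnorm_dg_proj -pert_sa -(diag_sa ipP uP _ _ bdd_st) /al -mulrA.
by rewrite ler_wpM2l ?invr_ge0 ?sqrtr_ge0 // (snorm_ip_le ipP).
Qed.

Lemma PEP_le_proj y : '|dg pt (E (dg pt y))| <= dp * '|dg proj y|.
Proof.
rewrite (dg_pt y) pertZ (diagZ ipP uP _ _ bdd_pt) rnormZ_real dg_proj pertZ.
rewrite (diagZ ipP uP _ _ bdd_pt) !rnormZ (rnorm_basis ipP uP) // mulr1.
rewrite rnorm_pt ger0_norm ?invr_ge0 ?sqrtr_ge0 // mulrCA mulrC.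
rewrite ler_wpM2r ?snorm_ge0 //.
rewrite mulrA -expr2 exprVn sqrtg_sqr mulrC ler_pdivrMr //.
by rewrite mulrC.
Qed.

Definition tratio := `|theta| / g.

Lemma tratio_ge0 : 0 <= tratio.
Proof. by rewrite divr_ge0 // ltW. Qed.

Lemma tratio_le : tratio <= dl.
Proof. by rewrite ler_pdivrMr // theta_le. Qed.

(* For an eigenvector q = W w of Sigmah at lamh j, the eigenvalue equation reads
   S E q = [dg tau] w, and [tau] has modulus close to 1 away from j. *)
Definition tau k := st k * wt k * (theta - nu k).

Lemma bdd_tau : bdd d tau.
Proof.
apply: bddM; first exact: bddM bdd_st bdd_wt.
exact: bddD (bdd_cst _ _) (bddN bdd_nu).
Qed.

Lemma st_wt k : in_dim d k -> k != j -> st k * wt k = `|nu k|^-1.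
Proof.
move=> dk kj; rewrite /st /coproj kj mul1r -expr2 /wt exprVn winv_sqr //.
by rewrite /om (negPf kj).
Qed.

Lemma tau_ge k : in_dim d k -> (1 - tratio) * coproj k <= `|tau k|.
Proof.
move=> dk; rewrite /coproj; case: eqP => [_|/eqP kj]; first by rewrite mulr0.
have nug := gap_norm dk kj; have nu0 : 0 < `|nu k| := lt_le_trans g_gt0 nug.
rewrite mulr1 /tau normrM st_wt // normfV normr_id mulrC ler_pdivlMr //.
have h : tratio * `|nu k| >= `|theta|.
  rewrite /tratio mulrAC ler_pdivlMr //; exact: ler_wpM2l.
have := ler_normB theta (theta - nu k); rewrite opprB addrCA subrr addr0 => h'.
rewrite mulrBl mul1r; apply: (@le_trans _ _ (`|nu k| - `|theta|)); last by lra.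
by lra.
Qed.

Lemma tau_le k : in_dim d k -> `|tau k| <= (1 + dl) * coproj k.
Proof.
move=> dk; rewrite /coproj; case: eqP => [kj|/eqP kj].
  by rewrite /tau /st /coproj kj eqxx !mul0r normr0 mulr0.
have nug := gap_norm dk kj; have nu0 : 0 < `|nu k| := lt_le_trans g_gt0 nug.
rewrite mulr1 /tau normrM st_wt // normfV normr_id mulrC ler_pdivrMr //.
have := ler_normB theta (nu k); have := theta_le.
have := ler_wpM2l dl_ge0 nug; lra.
Qed.

(** * Eigenvectors of [Sigmah] in the coordinates W^-1 q *)

Section Eigenvector.
Variable q : H.
Hypothesis qE : Sigmah q = sreal s (lamh j) *: q.
Let w := dg winv q.

Lemma pert_eigen : E q = sreal s theta *: q - dg nu q.
Proof. by rewrite /pert qE Sigma_nuE rmorphB scalerBl opprD addrCA addrC. Qed.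

Lemma S_pert_eigen : dg st (E q) = dg tau w.
Proof.
have bt := bdd_tau; have bs := bdd_st; have bn := bdd_nu; have bw := bdd_winv.
apply: (basis_ext uP) => l dl'.
rewrite pert_eigen !(coord_diag ipP uP) // (ipBr ipP) (ipZr ipP) !(coord_diag ipP uP) //.
rewrite /tau !rmorphM (rmorphB (@sreal R s) theta) /=.
have e1 : sreal s (wt l) * sreal s (winv l) = 1.
  by rewrite -rmorphM mulVf ?rmorph1 // gt_eqF // winv_gt0.
set A := sreal s (coproj l); set B := sreal s (wt l) in e1 *.
set C := sreal s (winv l) in e1 *; set D := ip (u l) q.
set F := sreal s (nu l); set G := sreal s theta.
transitivity (A * B * (B * C) * (G * D - F * D)); first by rewrite e1 mulr1.
by ring.
Qed.

Lemma rnorm_S_pert_le : '|dg st (E q)| <= (1 + dl) * '|dg coproj w|.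
Proof.
have h1 : 0 <= 1 + dl by move: dl_ge0; lra.
rewrite S_pert_eigen -{1}(ger0_norm h1) -rnormZ_real -(diag_scale ipP uP _ _ bdd_coproj).
apply: (rnorm_diag_le ipP uP bdd_tau (bddM (bdd_cst _ _) bdd_coproj)).
by move=> k dk _; apply: le_trans (tau_le dk) (ler_norm _).
Qed.

Lemma rnorm_S_pert_ge : (1 - tratio) * '|dg coproj w| <= '|dg st (E q)|.
Proof.
have h1 : 0 <= 1 - tratio by move: tratio_le dl_lt; lra.
rewrite S_pert_eigen -{1}(ger0_norm h1) -rnormZ_real -(diag_scale ipP uP _ _ bdd_coproj).
apply: (rnorm_diag_le ipP uP (bddM (bdd_cst _ _) bdd_coproj) bdd_tau).
move=> k dk _; rewrite ger0_norm ?tau_ge //.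
by rewrite mulr_ge0 // /coproj; case: eqP.
Qed.

Lemma proj_pert_eigen : dg proj (E q) = sreal s theta *: dg proj q.
Proof.
rewrite pert_eigen (diagB ipP uP _ _ bdd_proj) (diagZ ipP uP _ _ bdd_proj).
rewrite (diag_comp ipP uP _ bdd_proj bdd_nu).
suff -> : dg (fun k => proj k * nu k) q = 0 by rewrite subr0.
rewrite -[RHS](scale0r q) -(rmorph0 (@sreal R s)) -(diag_cst ipP uP).
by apply: eq_diag => k dk; rewrite /proj /nu; case: eqP => [->|_]; rewrite ?subrr ?mulr0 ?mul0r.
Qed.

Lemma rnorm_proj_w : '|dg proj w| = Num.sqrt g * '|dg proj q|.
Proof. by rewrite dg_proj_winv rnormZ_real ger0_norm // sqrtr_ge0. Qed.

Lemma rnorm_pt_pert : '|dg pt (E q)| = tratio * '|dg proj w|.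
Proof.
rewrite rnorm_pt proj_pert_eigen rnormZ_real rnorm_proj_w /tratio -{2}sqrtg_sqr.
by field; rewrite gt_eqF // sqrtg_gt0.
Qed.

Lemma q_split : q = dg st w + dg pt w.
Proof. by rewrite -dg_split dg_wtK. Qed.

(** Here [1 - 2 * dl] arises: S E q is at least [1 - tratio] times the part of [w] off [j], while
    the block S E S returns at most [dl] times that part, and [tratio <= dl]. *)
Lemma eigen_coproj_le_al : '|dg coproj w| <= al * cst * '|dg proj w|.
Proof.
have h := rnorm_S_pert_ge.
have h2 : '|dg st (E q)| <= dl * '|dg coproj w| + al * '|dg proj w|.
  rewrite {1}q_split pertD (diagD ipP uP _ _ bdd_st).
  apply: le_trans (rnormD _ _) _; rewrite SEP_eq lerD2r.
  apply: le_trans (SES_le_coproj _) _.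
  by rewrite ler_wpM2r ?rnorm_ge0.
have h3 : (1 - 2 * dl) * '|dg coproj w| <= al * '|dg proj w|.
  have := ler_wpM2r (rnorm_ge0 (dg coproj w)) tratio_le; lra.
have c0 : 0 < cst := lt_le_trans ltr01 cst_ge1.
rewrite mulrAC -ler_pdivrMr //.
by rewrite /cst invrK mulrC.
Qed.

(* Unlike [eigen_coproj_le_al], this bound does not degenerate as dl tends to 1/2. *)
Lemma eigen_coproj_le : '|dg coproj w| <= '|dg proj w|.
Proof.
rewrite -(@ler_pXn2r _ 2) ?nnegrE ?rnorm_ge0 //.
have h := WEW_le w; rewrite {1}dg_wtK in h.
have {}h : '|dg wt (E q)| ^+ 2 <= (dl * '|w|) ^+ 2.
  by rewrite ler_pXn2r // nnegrE ?mulr_ge0 ?rnorm_ge0.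
rewrite pythagoras_proj dg_coproj_wt dg_proj_wt exprMn (pythagoras_proj w) in h.
rewrite rnorm_pt_pert in h.
have h1 : ((1 - tratio) * '|dg coproj w|) ^+ 2 <= '|dg st (E q)| ^+ 2.
  rewrite ler_pXn2r ?nnegrE ?mulr_ge0 ?rnorm_ge0 ?rnorm_S_pert_ge //.
  by move: tratio_le dl_lt; lra.
move: h h1; rewrite !exprMn.
set X := '|dg coproj w| ^+ 2; set Y := '|dg proj w| ^+ 2; set Z := '|dg st _| ^+ 2.
have Y0 : 0 <= Y by exact: sqr_ge0.
have X0 : 0 <= X by exact: sqr_ge0.
rewrite -exprMn -/tratio => h h1; rewrite -subr_ge0.
have t0 := tratio_ge0; have td := tratio_le.
have m0 : 0 < (1 - tratio) ^+ 2 - dl ^+ 2 by move: dl_lt dl_ge0; nra.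
rewrite -(pmulr_rge0 _ m0).
(* With t = [tratio] this is 2 dl^2 <= 1/2 + 2 (t - 1/2)^2, which holds as soon as dl <= 1/2. *)
have mm : dl ^+ 2 - tratio ^+ 2 <= (1 - tratio) ^+ 2 - dl ^+ 2.
  have : dl ^+ 2 <= 4^-1 by move: dl_lt dl_ge0; nra.
  have := sqr_ge0 (tratio - 2^-1); nra.
have := ler_wpM2r Y0 mm; nra.
Qed.

Lemma eigen_proj_neq0 : q != 0 -> 0 < '|dg proj w|.
Proof.
move=> q0; rewrite lt_def rnorm_ge0 andbT; apply: contra q0 => /eqP w0.
have := eigen_coproj_le; rewrite w0 => wq0.
have : '|w| <= 0 by apply: le_trans (rnorm_le_proj _) _; rewrite w0 addr0.
rewrite le_eqVlt ltNge rnorm_ge0 orbF rnorm_eq0 => /eqP wz.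
by rewrite -(dg_wtK q) -/w wz (diag0r ipP uP bdd_wt).
Qed.

Lemma rnorm_coproj_q : '|dg coproj q| <= (Num.sqrt g)^-1 * '|dg coproj w|.
Proof.
by rewrite -{1}(dg_wtK q) dg_coproj_wt -dg_st_coproj rnorm_st_le.
Qed.

End Eigenvector.

Lemma coord_Sigmah x l : in_dim d l ->
  ip (uh l) (Sigmah x) = sreal s (lamh l) * ip (uh l) x.
Proof. by move=> dl'; apply: (coord_psum_lim ipP uhP) => //; exact: Sigmah_dec. Qed.

Lemma Sigmah_uh k : Sigmah (k *: uh j) = sreal s (lamh j) *: (k *: uh j).
Proof.
rewrite linearZ scalerA mulrC -scalerA; congr (_ *: _).
apply: (basis_ext uhP) => l dl'; rewrite coord_Sigmah // (ipZr ipP).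
case: uhP => uh_orth _; rewrite uh_orth //.
by case: eqP => [->//|_]; rewrite !mulr0.
Qed.

Lemma uh_neq0 : uh j != 0.
Proof. by rewrite -rnorm_eq0 (rnorm_basis ipP uhP) // oner_eq0. Qed.

(** Sharpens [tratio <= dl], so that a factor [theta] can supply a [dp]. The [u j] component of the
    eigenvalue equation gives tratio <= dp + al^2 cst; then al^2 <= dp dl and 1 + dl cst = (1 - dl)
    cst <= cst. *)
Lemma tratio_le_dp : tratio <= dp * cst.
Proof.
have qE : Sigmah (uh j) = sreal s (lamh j) *: uh j.
  by rewrite -{1 2}(scale1r (uh j)) Sigmah_uh scale1r.
have w0 := eigen_proj_neq0 qE uh_neq0; set w := dg winv (uh j) in w0.
rewrite -(ler_pM2r w0) -rnorm_pt_pert // {1}(q_split (uh j)) -/w.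
rewrite pertD (diagD ipP uP _ _ bdd_pt); apply: le_trans (rnormD _ _) _.
have h1 := PEP_le_proj w.
have h2 : '|dg pt (E (dg st w))| <= al * '|dg coproj w|.
  by rewrite -dg_st_coproj PES_le.
have h3 := ler_wpM2l al_ge0 (eigen_coproj_le_al qE); rewrite -/w in h3.
apply: (@le_trans _ _ ((al * (al * cst) + dp) * '|dg proj w|)); first by lra.
rewrite ler_wpM2r ?rnorm_ge0 //.
have c1 := cst_ge1; have ci := cst_inv.
have a0 := al_ge0; have c0 : 0 <= cst by lra.
have h4 : al * (al * cst) <= dp * (dl * cst).
  apply: ler_pM => //; first exact: mulr_ge0.
  by apply: ler_wpM2r => //; exact: le_trans dp_le.
have dp0 : 0 <= dp by exact: le_trans al_le.
have h5 : dp * (dl * cst) + dp <= dp * cst.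
  have -> : dp * (dl * cst) + dp = dp * (dl * cst + 1) by ring.
  rewrite ler_wpM2l // -ci.
  have : 0 <= dl * cst by rewrite mulr_ge0.
  lra.
by lra.
Qed.

(** * The perturbed projector and resolvent against [E] and a block *)

Lemma dgh_proj x : dgh proj x = ip (uh j) x *: uh j.
Proof. by rewrite -(eigenprojE ipP uhP). Qed.

Lemma Sigmah_dgh_proj x : Sigmah (dgh proj x) = sreal s (lamh j) *: dgh proj x.
Proof. by rewrite dgh_proj Sigmah_uh. Qed.

Lemma rnorm_dgh_proj_le x : '|dgh proj x| <= '|x|.
Proof.
rewrite -[leRHS]mul1r; apply: (rnorm_diag_bound ipP uhP) => // k _.
exact: norm_proj_le.
Qed.

Lemma rip_dgh_projE x : rip ip (dgh proj x) (dgh proj x) = rip ip x (dgh proj (dgh proj x)).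
Proof. exact: (diag_rsa ipP uhP _ _ bdd_proj). Qed.

Lemma cst_ge0 : 0 <= cst.
Proof. exact: le_trans ler01 cst_ge1. Qed.

Lemma dp_ge0 : 0 <= dp.
Proof. exact: le_trans al_ge0 al_le. Qed.

Lemma al_cst_ge0 : 0 <= al * cst.
Proof. exact: mulr_ge0 al_ge0 cst_ge0. Qed.

Lemma dp_cst_ge0 : 0 <= dp * cst.
Proof. exact: mulr_ge0 dp_ge0 cst_ge0. Qed.

Lemma sqrtgV_ge0 : 0 <= (Num.sqrt g)^-1.
Proof. by rewrite invr_ge0 sqrtr_ge0. Qed.

Lemma dl1_ge0 : 0 <= 1 + dl.
Proof. exact: addr_ge0. Qed.

(** The adjoint S E hat P_j only meets eigenvectors q, for which S E q is controlled by the part of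
    [w] off [j], hence by [al]. The factor sqrt g comes from returning from [w] to q along [u j]. *)
Lemma QES_le y :
  '|dgh proj (E (dg st y))| <= (1 + dl) * (al * cst) * Num.sqrt g * '|y|.
Proof.
have M0 : 0 <= (1 + dl) * (al * cst) * Num.sqrt g.
  exact: mulr_ge0 (mulr_ge0 dl1_ge0 al_cst_ge0) (sqrtr_ge0 _).
set x := dgh proj _; pose q := dgh proj x.
apply: (rnorm_le_adjoint ipP (z := dg st (E q)) M0).
  by rewrite rip_dgh_projE -/x -/q pert_rsa (diag_rsa ipP uP _ _ bdd_st) (ripC ipP).
have qE : Sigmah q = sreal s (lamh j) *: q := Sigmah_dgh_proj x.
apply: le_trans (rnorm_S_pert_le qE) _.
rewrite -!(mulrA (1 + dl)) ler_wpM2l ?dl1_ge0 //.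
apply: le_trans (eigen_coproj_le_al qE) _.
rewrite -(mulrA (al * cst)) ler_wpM2l ?al_cst_ge0 // rnorm_proj_w ler_wpM2l ?sqrtr_ge0 //.
exact: le_trans (rnorm_proj_le _) (rnorm_dgh_proj_le _).
Qed.

(** On an eigenvector, the [u j] component of [E q] is exactly [theta] times that of q;
    [tratio_le_dp] then yields [dp]. *)
Lemma QEP_le y : '|dgh proj (E (dg pt y))| <= dp * cst * Num.sqrt g * '|y|.
Proof.
have M0 : 0 <= dp * cst * Num.sqrt g.
  exact: mulr_ge0 dp_cst_ge0 (sqrtr_ge0 _).
set x := dgh proj _; pose q := dgh proj x.
apply: (rnorm_le_adjoint ipP (z := dg pt (E q)) M0).
  by rewrite rip_dgh_projE -/x -/q pert_rsa (diag_rsa ipP uP _ _ bdd_pt) (ripC ipP).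
have qE : Sigmah q = sreal s (lamh j) *: q := Sigmah_dgh_proj x.
rewrite (rnorm_pt_pert qE) rnorm_proj_w mulrA.
apply: ler_pM; rewrite ?rnorm_ge0 ?(mulr_ge0 tratio_ge0 (sqrtr_ge0 _)) //.
  by rewrite ler_wpM2r ?sqrtr_ge0 // tratio_le_dp.
exact: le_trans (rnorm_proj_le _) (rnorm_dgh_proj_le _).
Qed.

Definition muh k := lamh k - lam j.
(** The inverse of Sigmah - lam_j on the complement of [uh j]: centred at the unperturbed
    eigenvalue, hence not the reduced resolvent of [Sigmah] at [lamh j]. *)
Definition rt k := coproj k * (muh k)^-1.

Lemma rt_le k : in_dim d k -> `|rt k| <= 2 / g.
Proof.
move=> dk; rewrite /rt /coproj; case: eqP => [_|/eqP kj].
  by rewrite mul0r normr0 divr_ge0 // ltW.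
have h := lamh_sep dk kj; have g2 : 0 < g / 2 by rewrite divr_gt0.
have m0 := lt_le_trans g2 h.
by rewrite mul1r normfV -[leRHS]invf_div lef_pV2.
Qed.

Lemma bdd_rt : bdd d rt.
Proof. by exists (2 / g); exact: rt_le. Qed.

Lemma dgh_rt_Sigmah x : dgh rt (Sigmah x - sreal s (lam j) *: x) = dgh coproj x.
Proof.
have br := bdd_rt; have bc := bdd_coproj.
apply: (basis_ext uhP) => l dl'; rewrite !(coord_diag ipP uhP) // (ipBr ipP) (ipZr ipP).
rewrite coord_Sigmah // -mulrBl -rmorphB mulrA -rmorphM /rt /coproj /muh.
case: eqP => [_|/eqP lj]; first by rewrite !mul0r.
rewrite mul1r mulVf // -normr_gt0; apply: lt_le_trans (lamh_sep dl' lj).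
by rewrite divr_gt0.
Qed.

Lemma pert_u : E (u j) = Sigmah (u j) - sreal s (lam j) *: u j.
Proof. by rewrite /pert SigmaE (diag_eigen ipP uP) //; exact: bdd_eigenvalues. Qed.

(** The sine of the angle between the unit vectors [u j] and [uh j] is symmetric in them, so it can
    be read off the eigenvector [uh j]. *)
Lemma rnorm_dgh_coproj_u : '|dgh coproj (u j)| <= al * cst.
Proof.
have -> : '|dgh coproj (u j)| = '|dg coproj (uh j)|.
  apply: (@pexpIrn _ 2) => //; rewrite ?nnegrE ?rnorm_ge0 //.
  have h1 := pythagoras_basis (u j) uhP; have h2 := pythagoras_basis (uh j) uP.
  rewrite (rnorm_basis ipP uP) // dgh_proj rnormZ (rnorm_basis ipP uhP) // in h1.
  rewrite (rnorm_basis ipP uhP) // dg_proj rnormZ (rnorm_basis ipP uP) // in h2.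
  rewrite (ipC ipP (u j)) snorm_conj in h1.
  by rewrite h1 in h2; apply: (addIr _ h2).
have qE : Sigmah (uh j) = sreal s (lamh j) *: uh j.
  by rewrite -{1 2}(scale1r (uh j)) Sigmah_uh scale1r.
apply: le_trans (rnorm_coproj_q _) _.
rewrite mulrC ler_pdivrMr ?sqrtg_gt0 //.
apply: le_trans (eigen_coproj_le_al qE) _.
rewrite ler_wpM2l ?al_cst_ge0 // rnorm_proj_w.
rewrite -[leRHS]mulr1 ler_wpM2l ?sqrtr_ge0 //.
by apply: le_trans (rnorm_proj_le _) _; rewrite (rnorm_basis ipP uhP).
Qed.

(** Since E u_j = (Sigmah - lam_j) u_j, the resolvent cancels and leaves the part of [u j] off
    [uh j]. *)
Lemma RtEP_le y : '|dgh rt (E (dg pt y))| <= (Num.sqrt g)^-1 * (al * cst) * '|y|.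
Proof.
rewrite dg_pt dg_proj !pertZ !(diagZ ipP uhP _ _ bdd_rt) pert_u dgh_rt_Sigmah.
rewrite rnormZ_real rnormZ ger0_norm ?sqrtgV_ge0 // -(mulrA (_^-1)).
rewrite ler_wpM2l ?invr_ge0 ?sqrtr_ge0 // mulrC.
apply: ler_pM; rewrite ?rnorm_ge0 ?snorm_ge0 ?rnorm_dgh_coproj_u //.
by rewrite -rnorm_dg_proj rnorm_proj_le.
Qed.

(** Dual to [eigen_coproj_le]: orthogonality to [uh j] makes its pairings with the two parts of [x]
    opposite, so domination of the [u j] part in [uh j] forces the reverse domination in [x], in the
    weighted coordinates. *)
Lemma orth_proj_le x : ip (uh j) x = 0 ->
  '|dg proj (dg winv x)| <= '|dg coproj (dg winv x)|.
Proof.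
move=> vx; set xi := dg winv x.
have qE : Sigmah (uh j) = sreal s (lamh j) *: uh j.
  by rewrite -{1 2}(scale1r (uh j)) Sigmah_uh scale1r.
have w0 := eigen_proj_neq0 qE uh_neq0; have ww := eigen_coproj_le qE.
have g0 := sqrtg_gt0.
set w := dg winv (uh j) in w0 ww.
have split1 : dg proj x + dg coproj x = x.
  rewrite -(diag_add ipP uP _ bdd_proj bdd_coproj) -[RHS](diag1 ipP uP).
  by apply: eq_diag => k _; rewrite /proj /coproj; case: eqP; rewrite ?addr0 ?add0r.
have e1 : ip (uh j) (dg proj x) = - ip (uh j) (dg coproj x).
  by apply/eqP; rewrite -addr_eq0 -(ipDr ipP) split1 vx.
have e2 : snorm (ip (uh j) (dg proj x)) = '|dg proj (uh j)| * '|dg proj x|.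
  rewrite !rnorm_dg_proj dg_proj (ipZr ipP) snormM mulrC; congr (_ * _).
  by rewrite (ipC ipP (u j)) snorm_conj.
have e3 : snorm (ip (uh j) (dg coproj x)) <= '|dg coproj (uh j)| * '|dg coproj x|.
  have cc : dg coproj x = dg coproj (dg coproj x).
    rewrite (diag_comp ipP uP _ bdd_coproj bdd_coproj); apply: eq_diag => k _.
    by rewrite /coproj; case: eqP => _; rewrite ?mulr0 ?mulr1.
  by rewrite {1}cc -(diag_sa ipP uP _ _ bdd_coproj) (snorm_ip_le ipP).
have e4 : snorm (ip (uh j) (dg proj x)) = snorm (ip (uh j) (dg coproj x)).
  by rewrite e1 -scaleN1r snormM -(rmorphN1 (@sreal R s)) snorm_sreal normrN1 mul1r.
rewrite -(ler_pM2l w0).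
have -> : '|dg proj w| * '|dg proj xi| = g * ('|dg proj (uh j)| * '|dg proj x|).
  by rewrite !rnorm_proj_w -{3}sqrtg_sqr expr2 mulrACA.
rewrite -e2 e4.
apply: (@le_trans _ _ (g * ('|dg coproj (uh j)| * '|dg coproj x|))).
  by rewrite ler_wpM2l // ltW.
apply: (@le_trans _ _ ('|dg coproj w| * '|dg coproj xi|)); last first.
  by rewrite ler_wpM2r ?rnorm_ge0.
apply: (@le_trans _ _ (g * (((Num.sqrt g)^-1 * '|dg coproj w|) *
                            ((Num.sqrt g)^-1 * '|dg coproj xi|)))).
  by rewrite ler_wpM2l ?(ltW g_gt0) // ler_pM ?rnorm_ge0 ?rnorm_coproj_q.
rewrite -{1}sqrtg_sqr le_eqVlt; apply/orP; left; apply/eqP.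
by field; rewrite gt_eqF.
Qed.

(** Applying S to the equation bounds the part of W^-1 X off [j] by |S y| + dl |W^-1 X|, and by
    [orth_proj_le] the full norm is at most twice that part: a second origin of [1 - 2 * dl]. *)
Lemma inverse_coproj_le X y : ip (uh j) X = 0 -> dg nu X + E X = y ->
  '|dg coproj (dg winv X)| <= cst * ((Num.sqrt g)^-1 * '|y|).
Proof.
move=> vX eqX; have pc := orth_proj_le vX.
have h3 : '|dg coproj (dg winv X)| <= '|dg st (dg nu X)|.
  rewrite -{2}(dg_wtK X) (diag_comp ipP uP _ bdd_nu bdd_wt).
  rewrite (diag_comp ipP uP _ bdd_st (bddM bdd_nu bdd_wt)).
  apply: (rnorm_diag_le ipP uP bdd_coproj (bddM bdd_st (bddM bdd_nu bdd_wt))).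
  move=> k dk _; rewrite mulrCA mulrC; case: (eqVneq k j) => [->|kj].
    by rewrite {1}/coproj eqxx normr0.
  rewrite st_wt // normrM normfV normr_id mulVf ?norm_coproj_le //.
  by rewrite gt_eqF // (lt_le_trans g_gt0 (gap_norm dk kj)).
have h4 : '|dg st (E X)| <= dl * '|dg winv X|.
  apply: le_trans (WEW_le _); rewrite dg_wtK -dg_coproj_wt.
  exact: rnorm_coproj_le.
have h5 := rnorm_st_le y.
have h6 : '|dg st (dg nu X)| <= '|dg st y| + '|dg st (E X)|.
  have -> : dg st (dg nu X) = dg st y - dg st (E X).
    by rewrite -eqX (diagD ipP uP _ _ bdd_st) addrK.
  exact: rnormB.
have h8 := ler_wpM2l dl_ge0 (rnorm_le_proj (dg winv X)).
have h9 := ler_wpM2l dl_ge0 pc.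
have c0 : 0 < cst := lt_le_trans ltr01 cst_ge1.
rewrite mulrC -ler_pdivrMr // /cst invrK mulrC mulrBl mul1r lerBlDr.
apply: le_trans h3 _; apply: le_trans h6 _; apply: lerD h5 _.
apply: le_trans h4 _; apply: le_trans h8 _.
rewrite mulrDr -mulrA mulr_natl mulr2n lerD2l; exact: h9.
Qed.

(** Adjoint again: X = hat R x is orthogonal to [uh j] and solves (nu + E) X = (1 - hat P_j) x. The
    factor 2 counts the blocks S E S and S E P_j in S E X, each costing at most [dp] times the part
    off [j]. *)
Lemma RtES_le y : '|dgh rt (E (dg st y))| <= 2 * (Num.sqrt g)^-1 * (dp * cst) * '|y|.
Proof.
have M0 : 0 <= 2 * (Num.sqrt g)^-1 * (dp * cst).
  by rewrite (mulr_ge0 (mulr_ge0 _ sqrtgV_ge0) dp_cst_ge0).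
have [x xE] : exists x, x = dgh rt (E (dg st y)) by exists (dgh rt (E (dg st y))).
have [X XE] : exists X, X = dgh rt x by exists (dgh rt x).
rewrite -xE; apply: (rnorm_le_adjoint ipP (z := dg st (E X)) M0).
  rewrite {1}xE (diag_rsa ipP uhP _ _ bdd_rt) -XE pert_rsa (diag_rsa ipP uP _ _ bdd_st).
  by rewrite (ripC ipP).
have vX : ip (uh j) X = 0.
  rewrite XE (coord_diag ipP uhP _ bdd_rt j_dim) /rt /coproj eqxx.
  by rewrite mul0r rmorph0 mul0r.
have eqX : dg nu X + E X = dgh coproj x.
  have -> : dg nu X + E X = Sigmah X - sreal s (lam j) *: X.
    rewrite /pert Sigma_nuE opprD addrCA; congr (_ + _).
    by rewrite addrA subrr add0r.
  rewrite -dgh_rt_Sigmah; apply: (basis_ext uhP) => l dl'.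
  rewrite (coord_diag ipP uhP _ bdd_rt dl') !(ipBr ipP) !(ipZr ipP).
  rewrite !coord_Sigmah // XE (coord_diag ipP uhP _ bdd_rt dl').
  by rewrite -!mulrBl mulrCA.
have h2 := inverse_coproj_le vX eqX.
have h1 : '|dg st (E X)| <= 2 * dp * '|dg coproj (dg winv X)|.
  rewrite -{1}(dg_wtK X) dg_split pertD (diagD ipP uP _ _ bdd_st).
  apply: le_trans (rnormD _ _) _; rewrite SEP_eq -mulrA mulr_natl mulr2n.
  apply: lerD (SES_le_coproj _) _.
  exact: ler_pM al_ge0 (rnorm_ge0 _) al_le (orth_proj_le vX).
apply: le_trans h1 _.
have h3 : '|dg coproj (dg winv X)| <= cst * ((Num.sqrt g)^-1 * '|x|).
  apply: le_trans h2 _; rewrite ler_wpM2l ?cst_ge0 // ler_wpM2l ?sqrtgV_ge0 //.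
  rewrite -[leRHS]mul1r; apply: (rnorm_diag_bound ipP uhP) => // k _.
  exact: norm_coproj_le.
apply: le_trans (ler_wpM2l _ h3) _; first by rewrite mulr_ge0 ?dp_ge0.
rewrite le_eqVlt; apply/orP; left; apply/eqP.
by rewrite -!mulrA; congr (_ * _); rewrite [RHS]mulrCA; congr (_ * _); rewrite [RHS]mulrCA.
Qed.

(* Laurent coefficients of the resolvents at [lam j]: [rk k] belongs to R_j^(k), and
   [rh a b] to the coefficient of index a - b (possibly negative) of the perturbed
   resolvent, expanded in an annulus that separates [theta] from the other eigenvalues. *)
Definition rk k i : R := if k == 0%N then - proj i else coproj i * (nu i)^-1 ^+ k.
Definition rh a b i : R :=
  if (b < a)%N then rt i ^+ (a - b) else - proj i * theta ^+ (b - a).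

Lemma norm_rk_le k i : in_dim d i -> `|rk k i| <= g^-1 ^+ k.
Proof.
move=> di; rewrite /rk; case: eqP => [->|_]; first by rewrite normrN norm_proj_le.
rewrite /coproj; case: eqP => [_|/eqP ij].
  by rewrite mul0r normr0 exprn_ge0 // invr_ge0 ltW.
have nug := gap_norm di ij; have nu0 : 0 < `|nu i| := lt_le_trans g_gt0 nug.
rewrite mul1r normrX normfV lerXn2r ?nnegrE ?invr_ge0 ?(ltW g_gt0) ?(ltW nu0) //.
by rewrite lef_pV2.
Qed.

Lemma bdd_rk k : bdd d (rk k).
Proof. by exists (g^-1 ^+ k); exact: norm_rk_le. Qed.

Lemma norm_rh_lt_le a b i : in_dim d i -> (b < a)%N -> `|rh a b i| <= (2 / g) ^+ (a - b).
Proof.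
move=> di ba; rewrite /rh ba normrX lerXn2r ?nnegrE ?rt_le //.
by rewrite divr_ge0 // ltW.
Qed.

Lemma norm_rh_ge_le a b i : (a <= b)%N -> `|rh a b i| <= `|theta| ^+ (b - a).
Proof.
move=> ab; rewrite /rh ltnNge ab /= normrM normrN normrX.
by rewrite ler_piMl ?exprn_ge0 ?norm_proj_le.
Qed.

Lemma bdd_rh a b : bdd d (rh a b).
Proof.
have [ab|ba] := leqP a b.
  by exists (`|theta| ^+ (b - a)) => i _; exact: norm_rh_ge_le.
by exists ((2 / g) ^+ (a - b)) => i di; exact: norm_rh_lt_le.
Qed.

(** * Laurent coefficients and the second resolvent identity *)

Local Notation Rk k := (dg (rk k)).
Local Notation Rh a b := (dgh (rh a b)).

Lemma resolventE x : resolvent ip d lam u j x = dg (fun i => coproj i * (nu i)^-1) x.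
Proof.
rewrite /resolvent off_diagE; apply: eq_diag => k _; rewrite /coproj /nu.
by case: eqP; rewrite ?mul0r ?mul1r.
Qed.

Lemma resolvent_powE k x : resolvent_pow ip d lam u j k x = Rk k x.
Proof.
case: k => [|k].
  rewrite /resolvent_pow (eigenprojE ipP uP) // -scaleN1r -(rmorphN1 (@sreal R s)).
  rewrite -(diag_scale ipP uP _ _ bdd_proj).
  by apply: eq_diag => i _; rewrite mulN1r.
have b1 : bdd d (fun i => coproj i * (nu i)^-1).
  by have [M h] := bdd_rk 1; exists M => i di; have := h i di; rewrite /rk expr1.
rewrite /resolvent_pow; elim: k => [|k IH].
  by rewrite /= resolventE; apply: eq_diag => i _; rewrite /rk expr1.
rewrite iterS IH resolventE (diag_comp ipP uP _ b1 (bdd_rk _)).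
apply: eq_diag => i _; rewrite /rk /= [in RHS]exprS /coproj.
by case: eqP; rewrite ?mul0r ?mul1r.
Qed.

(** The coefficient recurrence of (Sigmah - z) times its resolvent being the identity: the identity
    contributes only where the index a - b is 0. *)
Lemma rh_muh a b i : in_dim d i ->
  rh a.+1 b i * muh i = rh a b i + (a == b)%:R.
Proof.
move=> di; have rtm : rt i * muh i = coproj i.
  rewrite /rt /coproj; case: eqP => [_|/eqP ij]; first by rewrite !mul0r.
  rewrite mul1r mulVf // -normr_gt0; apply: lt_le_trans (lamh_sep di ij).
  by rewrite divr_gt0.
have rtc : rt i * coproj i = rt i.
  by rewrite /rt /coproj; case: eqP => _; rewrite ?mul0r ?mulr1.
rewrite /rh ltnS; case: (ltngtP b a) => [ba|ab|->].
- rewrite addr0 subSn ?(ltnW ba) // exprSr -mulrA rtm.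
  by case: (a - b)%N (subn_gt0 b a) => [|n _]; rewrite ?ba // exprSr -mulrA rtc.
- rewrite addr0 -mulrA /proj; case: eqP => [->|_]; last by rewrite oppr0 !mul0r.
  by rewrite /muh -exprSr subnSK.
- rewrite subSnn expr1 rtm subnn expr0 mulr1 /coproj /proj.
  by case: eqP; rewrite ?addNr ?oppr0 ?add0r.
Qed.

Lemma nu_rk0 i : nu i * rk 0 i = 0.
Proof.
by rewrite /rk /= /proj; case: eqP => [->|_]; rewrite ?oppr0 ?mulr0 // /nu subrr mul0r.
Qed.

Lemma nu_rkS k i : in_dim d i -> nu i * rk k.+1 i = rk k i + (k == 0%N)%:R.
Proof.
move=> di; rewrite /rk /= /coproj /proj; case: (eqVneq i j) => [->|ij] /=.
  rewrite !mul0r mulr0; case: eqP => _; last by rewrite addr0.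
  by rewrite addNr.
have nu0 : nu i != 0 by rewrite -normr_gt0 (lt_le_trans g_gt0) // gap_norm.
rewrite !mul1r exprS mulrA mulfV // mul1r.
by case: eqP => [->|_]; rewrite ?oppr0 ?add0r ?addr0.
Qed.

Lemma Rh_Sigmah a b z : Rh a.+1 b (Sigmah z - sreal s (lam j) *: z) =
  Rh a b z + (if a == b then z else 0).
Proof.
have b1 := bdd_rh a.+1 b; have b2 := bdd_rh a b.
apply: (basis_ext uhP) => l dl'; rewrite (ipDr ipP) !(coord_diag ipP uhP) //.
rewrite (ipBr ipP) (ipZr ipP) coord_Sigmah // -mulrBl -rmorphB mulrA -rmorphM.
rewrite -/(muh l) rh_muh // rmorphD mulrDl; congr (_ + _).
by case: eqP => _; rewrite ?(rmorph1 (@sreal R s)) ?rmorph0 ?mul1r ?mul0r ?(ip0r ipP).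
Qed.

Lemma nu_Rk0 y : dg nu (Rk 0 y) = 0.
Proof.
rewrite (diag_comp ipP uP _ bdd_nu (bdd_rk 0)) -(scale0r y) -(rmorph0 (@sreal R s)).
by rewrite -(diag_cst ipP uP); apply: eq_diag => i _; exact: nu_rk0.
Qed.

Lemma nu_RkS k y : dg nu (Rk k.+1 y) = Rk k y + (if k == 0%N then y else 0).
Proof.
rewrite (diag_comp ipP uP _ bdd_nu (bdd_rk k.+1)).
transitivity (dg (fun i => rk k i + (k == 0%N)%:R) y).
  by apply: eq_diag => i di; exact: nu_rkS.
rewrite (diag_add ipP uP _ (bdd_rk k) (bdd_cst _ _)) (diag_cst ipP uP); congr (_ + _).
by case: eqP => _; rewrite ?(rmorph1 (@sreal R s)) ?rmorph0 ?scale1r ?scale0r.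
Qed.

Lemma pertE z : E z = (Sigmah z - sreal s (lam j) *: z) - dg nu z.
Proof. by rewrite /pert Sigma_nuE opprD -addrA [- _ - _]addrC addrA. Qed.

Lemma rh_SS a b x : Rh a.+1 b.+1 x = Rh a b x.
Proof. by apply: eq_diag => i _; rewrite /rh ltnS !subSS. Qed.

(* Telescoping form of the second resolvent identity. *)
Lemma Rh_pert_Rk_sum a b L y :
  \sum_(l < L.+1) Rh a.+1 (b + l)%N (E (Rk l y)) =
  Rh a (b + L)%N (Rk L y) + \sum_(l < L.+1) (if a == (b + l)%N then Rk l y else 0)
  - (if L == 0%N then 0 else Rh a b y).
Proof.
have step l : Rh a.+1 (b + l)%N (E (Rk l y)) = Rh a (b + l)%N (Rk l y)
    + (if a == (b + l)%N then Rk l y else 0) - Rh a.+1 (b + l)%N (dg nu (Rk l y)).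
  by rewrite pertE (diagB ipP uhP _ _ (bdd_rh _ _)) Rh_Sigmah.
elim: L => [|L IH].
  by rewrite !big_ord_recl !big_ord0 /= !addr0 step nu_Rk0 (diag0r ipP uhP (bdd_rh _ _)).
rewrite big_ord_recr /= IH [in RHS]big_ord_recr /= step nu_RkS.
rewrite addnS rh_SS (diagD ipP uhP _ _ (bdd_rh _ _)).
set A := Rh a (b + L)%N (Rk L y); set B := \sum_(_ < _) _.
set C := Rh a (b + L)%N.+1 _; set F := (if a == _ then _ else _).
case: eqP => [->|_]; last first.
  rewrite (diag0r ipP uhP (bdd_rh _ _)) addr0.
  by rewrite [LHS]addrC !addrA subrK (addrAC C).
by rewrite addn0 subr0 [LHS]addrC (addrC A) opprD !addrA subrK addrAC (addrAC C).
Qed.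

(** The bound [a <= b + L] keeps the index l = a - b, the only one that produces an unperturbed
    term, inside the cut-off sum; the last summand is the boundary term of the telescoping. *)
Lemma Rh_expand a b L y : (0 < L)%N -> (a <= b + L)%N ->
  Rh a b y = (if (b <= a)%N then Rk (a - b)%N y else 0)
    - \sum_(l < L.+1) Rh a.+1 (b + l)%N (E (Rk l y)) + Rh a (b + L)%N (Rk L y).
Proof.
move=> L0 abL; rewrite Rh_pert_Rk_sum gtn_eqF //.
have -> : \sum_(l < L.+1) (if a == (b + l)%N then Rk l y else 0) =
          if (b <= a)%N then Rk (a - b)%N y else 0.
  case: leqP => [ba|ab]; last first.
    by rewrite big1 // => l _; rewrite ltn_eqF // (leq_trans ab) // leq_addr.
  have abL' : (a - b < L.+1)%N by rewrite ltnS leq_subLR.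
  rewrite (bigD1 (Ordinal abL')) //= subnKC // eqxx big1 ?addr0 // => l lab.
  case: eqP => // alb; case/eqP: lab; apply/val_inj => /=.
  by rewrite alb addKn.
set I := (if _ then _ else _); set T := Rh a (b + L)%N _.
by rewrite opprB addrCA (addrC T) opprD (addrA I) subrr add0r subrK.
Qed.

(** * Expansion of the perturbed projector in words *)

Definition word (t : seq nat) (x : H) : H := foldr (fun k y => E (Rk k y)) x t.

Lemma resolvent_wordE k t x :
  resolvent_word ip d lam u E j (k :: t) x = Rk k (word t x).
Proof.
elim: t k => [|l t IH] k; first by rewrite /= resolvent_powE.
have -> : resolvent_word ip d lam u E j [:: k, l & t] x =
  resolvent_pow ip d lam u j k (E (resolvent_word ip d lam u E j (l :: t) x)) by [].
by rewrite IH resolvent_powE.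
Qed.

(** A letter stands for [E] followed by R_j^(k), and the perturbed factor in front has index p -
    sumn t, so the indices add up to [p]. The boundary terms of the cut-off are collected in
    [truncation]. *)
Definition remainder L p x := nsum L p (fun t => Rh p (sumn t) (word t x)).
Definition truncation L p x := nsum L p (fun t => Rh p (sumn t + L)%N (Rk L (word t x))).

Lemma proj_termE L n x : (n <= L)%N -> proj_term ip d lam u E j n x =
  (-1) ^+ n.+1 *: nsum L n (fun t =>
    if (sumn t <= n)%N then Rk (n - sumn t)%N (word t x) else 0).
Proof.
move=> nL; rewrite /proj_term; congr (_ *: _).
transitivity (nsum n n.+1 (fun t =>
    if sumn t == n then resolvent_word ip d lam u E j t x else 0)).
  rewrite /nsum big_mkcond; apply: eq_bigr => t _.
  suff -> : (\sum_(i < n.+1) tnth t i)%N = sumn (map val t) by [].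
  by rewrite sumnE big_map big_tuple.
rewrite (nsum_compositions (fun t => resolvent_word ip d lam u E j t x) nL).
by apply: eq_nsum => t _; case: ifP => // _; rewrite resolvent_wordE.
Qed.

(** [Rh_expand] is applied to the perturbed factor of each word; the summation letter becomes the
    new first letter. *)
Lemma remainder_step L p x : (0 < L)%N -> (p <= L)%N ->
  remainder L p x = (-1) ^+ p.+1 *: proj_term ip d lam u E j p x
    - remainder L p.+1 x + truncation L p x.
Proof.
move=> L0 pL; rewrite (proj_termE x pL) scalerA -exprMn mulrNN mulr1 expr1n scale1r.
rewrite /remainder nsumS exchange_big /= /truncation /nsum -sumrB -big_split /=.
apply: eq_bigr => t _; rewrite (@Rh_expand p _ L) //; last first.
  exact: leq_trans pL (leq_addl _ _).
by congr (_ - _ + _); apply: eq_bigr => l _; rewrite addnC.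
Qed.

Lemma perturbation_expansion L p x : (p <= L)%N ->
  eigenproj ip uh j x - \sum_(0 <= n < p) proj_term ip d lam u E j n x =
  (-1) ^+ p.+1 *: remainder L p x
  + \sum_(0 <= n < p) (-1) ^+ n.+1 *: truncation L n x.
Proof.
elim: p => [_|p IH pL].
  (* For p = 0 only the empty word remains, and the coefficient of index 0 is - hat P_j. *)
  rewrite !big_geq // subr0 addr0 /remainder nsum0 /= expr1 scaleN1r.
  rewrite (eigenprojE ipP uhP) // -scaleN1r -(rmorphN1 (@sreal R s)).
  rewrite -(diag_scale ipP uhP _ _ (bdd_rh _ _)).
  by apply: eq_diag => i _; rewrite /rh /= expr0 mulr1 mulN1r opprK.
rewrite !big_nat_recr //= opprD addrA IH ?(ltnW pL) //.
rewrite (remainder_step x (leq_ltn_trans (leq0n _) pL) (ltnW pL)).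
rewrite !scalerDr scalerA -exprMn mulrNN mulr1 expr1n scale1r scalerN.
rewrite -scaleNr -[- (-1) ^+ p.+1]mulN1r -exprS.
set A := proj_term _ _ _ _ _ _ _ _; set B := _ *: remainder _ _ _.
set C := _ *: truncation _ _ _; set D := \sum_(_ <= _ < _) _.
by rewrite [A + B]addrC -!addrA; congr (_ + _); rewrite addrC -!addrA addNr addr0 addrC.
Qed.

(** * Block factorisation and the estimate of a single word *)

Definition blk (b : bool) := if b then st else pt.
(** The middle factor M of R_j^(k) = U M U. Its norm is at most g^(1-k), the same power for both
    blocks. *)
Definition mk k i := om i * rk k i.

Lemma bdd_blk b : bdd d (blk b).
Proof. by case: b; [exact: bdd_st|exact: bdd_pt]. Qed.

Lemma norm_mk_le k i : in_dim d i -> `|mk k i| <= g * g^-1 ^+ k.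
Proof.
move=> di; rewrite /mk /om; case: (eqVneq i j) => [->|ij].
  rewrite normrM (ger0_norm (ltW g_gt0)) ler_wpM2l ?(ltW g_gt0) //.
  exact: norm_rk_le.
have nug := gap_norm di ij; have nu0 : 0 < `|nu i| := lt_le_trans g_gt0 nug.
rewrite /rk /coproj /proj ij (negPf ij); case: k => [|k].
  by rewrite /= oppr0 mulr0 normr0 mulr1 ltW.
rewrite mul1r normrM normr_id normrX normfV !exprS !mulrA !mulfV ?gt_eqF // !mul1r.
by rewrite lerXn2r ?nnegrE ?invr_ge0 ?(ltW g_gt0) ?(ltW nu0) // lef_pV2.
Qed.

Lemma bdd_mk k : bdd d (mk k).
Proof. by exists (g * g^-1 ^+ k); exact: norm_mk_le. Qed.

Lemma RkE k x : Rk k x = dg (blk (0 < k)%N) (dg (mk k) (dg (blk (0 < k)%N) x)).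
Proof.
have bb := bdd_blk (0 < k)%N; have bm := bdd_mk k.
rewrite (diag_comp ipP uP _ bm bb) (diag_comp ipP uP _ bb (bddM bm bb)).
apply: eq_diag => i di; rewrite /mk.
have wo : wt i * om i * wt i = 1.
  by rewrite -(winv_sqr di) /wt expr2; field; rewrite gt_eqF // winv_gt0.
have e (c : R) : c * wt i * (om i * rk k i * (c * wt i)) = c * c * rk k i.
  by rewrite -[RHS]mulr1 -wo; ring.
case: k {bb bm} e => [|k] e; rewrite /= /pt /st e /rk /=.
  by rewrite /proj; case: eqP; rewrite ?mul1r // !mul0r oppr0.
by rewrite /coproj; case: eqP; rewrite ?mul1r // !mul0r.
Qed.

Lemma blk_pert_le b b' y :
  '|dg (blk b) (E (dg (blk b') y))| <= (if b == b' then dp else al) * '|y|.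
Proof.
case: b; case: b' => /=; first exact: SES_le.
- by rewrite SEP_eq ler_wpM2l ?al_ge0 ?rnorm_proj_le.
- exact: PES_le.
- by apply: le_trans (PEP_le_proj _) _; rewrite ler_wpM2l ?dp_ge0 ?rnorm_proj_le.
Qed.

Lemma rnorm_blk_le b x : '|dg (blk b) x| <= (Num.sqrt g)^-1 * '|x|.
Proof.
case: b => /=; first exact: rnorm_st_le.
by rewrite rnorm_pt ler_wpM2l ?sqrtgV_ge0 ?rnorm_proj_le.
Qed.

Lemma rnorm_mk_le k x : '|dg (mk k) x| <= g * g^-1 ^+ k * '|x|.
Proof.
apply: (rnorm_diag_bound ipP uP); first exact: norm_mk_le.
by rewrite mulr_ge0 ?exprn_ge0 ?invr_ge0 ?(ltW g_gt0).
Qed.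

Definition same_blk k (t : seq nat) := all (fun l => (0 < l)%N == (0 < k)%N) t.
(** Bounds the product of the factors of [blk_pert_le] along [k :: t]. One [al] is kept if the block
    ever changes; further ones are weakened to [dp]. *)
Definition beta k t : R :=
  if same_blk k t then dp ^+ size t else al * dp ^+ (size t).-1.

Lemma beta_ge0 k t : 0 <= beta k t.
Proof.
by rewrite /beta; case: ifP => _; rewrite ?exprn_ge0 ?dp_ge0 // mulr_ge0 ?al_ge0 ?exprn_ge0 ?dp_ge0.
Qed.

Lemma beta_le k t : beta k t <= dp ^+ size t.
Proof.
rewrite /beta; case: ifP => //; case: t => //= l t _.
by rewrite exprS ler_wpM2r ?exprn_ge0 ?dp_ge0.
Qed.

Lemma beta_cons k l t :
  (if (0 < k)%N == (0 < l)%N then dp else al) * beta l t <= beta k (l :: t).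
Proof.
rewrite {2}/beta /= [(0 < l)%N == _]eq_sym; case: eqP => [kl|_] /=; last first.
  by rewrite ler_wpM2l ?al_ge0 ?beta_le.
have -> : same_blk k t = same_blk l t by rewrite /same_blk kl.
rewrite /beta; case: ifP => [_|]; first by rewrite -exprS.
by case: t => //= m t _; rewrite mulrCA -exprS.
Qed.

Lemma gpow_ge0 (m n : nat) : 0 <= g ^+ m * g^-1 ^+ n.
Proof. by rewrite mulr_ge0 ?exprn_ge0 ?invr_ge0 ?(ltW g_gt0). Qed.

(** The leftmost block factor U is left open for the [E] that precedes it. Each middle factor
    contributes g^(1-l), and the rightmost U the isolated g^{-1/2}. *)
Lemma word_tail k t x : exists z,
  Rk k (word t x) = dg (blk (0 < k)%N) (dg (mk k) z) /\
  '|z| <= (Num.sqrt g)^-1 * (g ^+ size t * g^-1 ^+ sumn t) * beta k t * '|x|.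
Proof.
elim: t k => [|l t IH] k.
  exists (dg (blk (0 < k)%N) x); split; first by rewrite -RkE.
  by rewrite /= /beta /= !expr0 !mulr1 rnorm_blk_le.
have [z [zE zle]] := IH l.
exists (dg (blk (0 < k)%N) (E (dg (blk (0 < l)%N) (dg (mk l) z)))).
split; first by rewrite -RkE -zE.
apply: le_trans (blk_pert_le _ _ _) _.
have h := le_trans (rnorm_mk_le l z) (ler_wpM2l (gpow_ge0 1 l) zle).
have c0 : 0 <= (if (0 < k)%N == (0 < l)%N then dp else al).
  by case: ifP => _; [exact: dp_ge0|exact: al_ge0].
apply: le_trans (ler_wpM2l c0 h) _.
rewrite [leLHS](_ : _ = (Num.sqrt g)^-1 * (g ^+ (size t).+1 * g^-1 ^+ (l + sumn t)) *
    ((if (0 < k)%N == (0 < l)%N then dp else al) * beta l t) * '|x|); last first.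
  by rewrite exprD (exprS g (size t)) expr1; ring.
rewrite ler_wpM2r ?rnorm_ge0 // ler_wpM2l ?beta_cons //.
by rewrite mulr_ge0 ?sqrtgV_ge0 ?gpow_ge0.
Qed.

(** Since (1 + dl)(1 - 2 dl) <= 1. A second power of [cst] pays for the [1 + dl] of [QES_le]. *)
Lemma cst_dl1 : (1 + dl) * cst <= cst ^+ 2.
Proof.
rewrite expr2 ler_wpM2r ?cst_ge0 // -[leRHS]mul1r -ler_pdivrMr; last first.
  exact: lt_le_trans ltr01 cst_ge1.
by rewrite /cst invrK; move: dl_ge0; nra.
Qed.

Lemma cst_le_sqr : cst <= cst ^+ 2.
Proof. by rewrite expr2 ler_peMl ?cst_ge0 ?cst_ge1. Qed.

Lemma same_blk0_sumn t : same_blk 0 t -> sumn t = 0%N.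
Proof. by elim: t => //= -[|l] t IH //= /IH. Qed.

Lemma same_blk_size k t : (0 < k)%N -> same_blk k t -> (size t <= sumn t)%N.
Proof. by case: k => // k _; elim: t => //= -[|l] t IH //= /IH h; rewrite addSn ltnS (leq_trans h) ?leq_addl. Qed.

Lemma Rh_neg a b z : (a <= b)%N ->
  Rh a b z = sreal s (- theta ^+ (b - a)) *: dgh proj z.
Proof.
move=> ab; rewrite -(diag_scale ipP uhP _ _ bdd_proj); apply: eq_diag => i _.
by rewrite /rh ltnNge ab /= mulNr mulNr mulrC.
Qed.

(** One factor [rt] is split off, to be estimated together with the [E] and the block that follow
    it. *)
Lemma Rh_pos_le a b z : (b < a)%N ->
  '|Rh a b z| <= (2 / g) ^+ (a - b).-1 * '|dgh rt z|.
Proof.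
move=> ba; pose c i := rt i ^+ (a - b).-1.
have cle i : in_dim d i -> `|c i| <= (2 / g) ^+ (a - b).-1.
  move=> di; rewrite normrX lerXn2r ?nnegrE ?rt_le //.
  by rewrite divr_ge0 // ltW.
have bc : bdd d c by exists ((2 / g) ^+ (a - b).-1).
have -> : Rh a b z = dgh c (dgh rt z).
  rewrite (diag_comp ipP uhP _ bc bdd_rt); apply: eq_diag => i _.
  by rewrite /rh ba -exprSr prednK // subn_gt0.
apply: (rnorm_diag_bound ipP uhP) => //.
by rewrite exprn_ge0 // divr_ge0 // ltW.
Qed.

Definition word_const p := al * dp ^+ p.-1 * cst ^+ 2.

Lemma word_const_ge0 p : 0 <= word_const p.
Proof.
exact: mulr_ge0 (mulr_ge0 al_ge0 (exprn_ge0 _ dp_ge0)) (exprn_ge0 _ cst_ge0).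
Qed.

Lemma tratio_pow_le m : tratio ^+ m <= 2^-1 ^+ m.
Proof.
rewrite lerXn2r ?nnegrE ?tratio_ge0 ?invr_ge0 //.
exact: le_trans tratio_le (ltW dl_lt).
Qed.

Lemma theta_pow m : `|theta| ^+ m = tratio ^+ m * g ^+ m.
Proof. by rewrite -exprMn /tratio divfK // gt_eqF. Qed.

(* A letter k <> 0 lives in the block of |R_j|^{1/2}, a letter 0 in that of P_j, and
   every change of block yields a factor [al]. The words have length p and k_0 + sumn t = p
   for the index k_0 of the perturbed factor; so either the letters change block, or the
   perturbed factor supplies [al]. *)
Lemma word_le t x : (0 < size t)%N ->
  '|Rh (size t) (sumn t) (word t x)| <=
    2 ^+ size t * 2^-1 ^+ sumn t * word_const (size t) * '|x|.
Proof.
case: t => // k t _; have [z [zE zle]] := word_tail k t x.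
have -> : word (k :: t) x = E (dg (blk (0 < k)%N) (dg (mk k) z)) by rewrite /= zE.
set y := dg (mk k) z; set p := size (k :: t); set S := sumn (k :: t).
have yle : '|y| <= (Num.sqrt g)^-1 * (g ^+ p * g^-1 ^+ S) * (beta k t * '|x|).
  apply: le_trans (rnorm_mk_le k z) _.
  apply: le_trans (ler_wpM2l (gpow_ge0 1 k) zle) _.
  by rewrite le_eqVlt; apply/orP; left; apply/eqP; rewrite /p /S /= exprD (exprS g (size t)) expr1; ring.
clearbody y; set X := beta k t * '|x| in yle.
have X0 : 0 <= X by rewrite mulr_ge0 ?beta_ge0 ?rnorm_ge0.
have gn0 : g != 0 by rewrite gt_eqF.
have sg0 : Num.sqrt g != 0 by rewrite gt_eqF // sqrtg_gt0.
have [pS|Sp] := leqP p S.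
  have [m Sm] : exists m, S = (p + m)%N by exists (S - p)%N; rewrite subnKC.
  have gm : g ^+ p * g^-1 ^+ S = g^-1 ^+ m.
    by rewrite Sm exprD mulrA -exprMn mulfV // expr1n mul1r.
  have hm : 2 ^+ p * 2^-1 ^+ S = 2^-1 ^+ m :> R.
    by rewrite Sm exprD mulrA -exprMn mulfV // expr1n mul1r.
  rewrite Rh_neg // rnormZ_real normrN normrX Sm addKn -Sm hm theta_pow.
  rewrite gm in yle.
  (* [kap] is the constant for hat P_j E U; the sqrt g beside it cancels the g^{-1/2} of
     [word_tail]. *)
  have main kap : 0 <= kap ->
      '|dgh proj (E (dg (blk (0 < k)%N) y))| <= kap * Num.sqrt g * '|y| ->
      kap * beta k t <= word_const p ->
      tratio ^+ m * g ^+ m * '|dgh proj (E (dg (blk (0 < k)%N) y))| <=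
      2^-1 ^+ m * word_const p * '|x|.
    move=> kap0 h1 h2.
    apply: (@le_trans _ _ (tratio ^+ m * g ^+ m *
      (kap * Num.sqrt g * ((Num.sqrt g)^-1 * g^-1 ^+ m * X)))).
      rewrite ler_wpM2l ?mulr_ge0 ?exprn_ge0 ?tratio_ge0 ?(ltW g_gt0) //.
      apply: le_trans h1 _; rewrite ler_wpM2l // mulr_ge0 // sqrtr_ge0.
    rewrite [leLHS](_ : _ = tratio ^+ m * (kap * X)); last first.
      by rewrite exprVn; field; rewrite sg0 expf_neq0.
    rewrite -mulrA; apply: ler_pM.
    - by rewrite exprn_ge0 // tratio_ge0.
    - by rewrite mulr_ge0.
    - exact: tratio_pow_le.
    - by rewrite /X mulrA ler_wpM2r ?rnorm_ge0.
  have k_cases : k = 0%N \/ (0 < k)%N by case: (k); [left|right].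
  case: k_cases => [k0|kgt0].
    apply: (main (dp * cst)); first exact: dp_cst_ge0.
      by rewrite k0; exact: QEP_le.
    (* A word of zeros has sum 0, contradicting [p <= S]. *)
    have nsb : same_blk k t = false.
      by apply/negP; rewrite k0 => /same_blk0_sumn t0; move: pS; rewrite /p /S /= t0 k0.
    rewrite /beta nsb /word_const /p /=.
    have -> : dp ^+ size t = dp * dp ^+ (size t).-1.
      by rewrite -exprS; case: (t) nsb.
    rewrite [leLHS](_ : _ = al * (dp * dp ^+ (size t).-1) * cst); last by ring.
    rewrite ler_wpM2l ?cst_le_sqr //.
    exact: mulr_ge0 al_ge0 (mulr_ge0 dp_ge0 (exprn_ge0 _ dp_ge0)).
  apply: (main ((1 + dl) * (al * cst))); first exact: mulr_ge0 dl1_ge0 al_cst_ge0.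
    by rewrite kgt0; exact: QES_le.
  rewrite /word_const /p /=.
  rewrite [leLHS](_ : _ = al * ((1 + dl) * cst * beta k t)); last by ring.
  have -> : al * dp ^+ size t * cst ^+ 2 = al * (dp ^+ size t * cst ^+ 2) by ring.
  rewrite ler_wpM2l ?al_ge0 // mulrC; apply: ler_pM.
  - exact: beta_ge0.
  - exact: mulr_ge0 dl1_ge0 cst_ge0.
  - exact: beta_le.
  - exact: cst_dl1.
have [m Sm] : exists m, p = (S + m.+1)%N by exists (p - S).-1; rewrite prednK ?subnKC ?subn_gt0 // ltnW.
have gm : g ^+ p * g^-1 ^+ S = g ^+ m.+1.
  by rewrite Sm exprD mulrAC -exprMn mulfV // expr1n mul1r.
have hm : 2 ^+ p * 2^-1 ^+ S = 2 ^+ m.+1 :> R.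
  by rewrite Sm exprD mulrAC -exprMn mulfV // expr1n mul1r.
apply: le_trans (Rh_pos_le _ Sp) _.
have -> : (p - S).-1 = m by rewrite Sm addKn.
rewrite hm; rewrite gm in yle.
(* The two factors g^{-1/2} lower g^(m+1) to g^m, which cancels against (2/g)^m. The 2 left over
   from 2^(m+1) pays for the one in [RtES_le]. *)
have main kap : 0 <= kap ->
    '|dgh rt (E (dg (blk (0 < k)%N) y))| <= kap * (Num.sqrt g)^-1 * '|y| ->
    kap * beta k t <= 2 * word_const p ->
    (2 / g) ^+ m * '|dgh rt (E (dg (blk (0 < k)%N) y))| <= 2 ^+ m.+1 * word_const p * '|x|.
  move=> kap0 h1 h2.
  apply: (@le_trans _ _ ((2 / g) ^+ m *
    (kap * (Num.sqrt g)^-1 * ((Num.sqrt g)^-1 * g ^+ m.+1 * X)))).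
    rewrite ler_wpM2l ?exprn_ge0 ?divr_ge0 ?(ltW g_gt0) //.
    apply: le_trans h1 _; rewrite ler_wpM2l // mulr_ge0 // sqrtgV_ge0.
  rewrite [leLHS](_ : _ = 2 ^+ m * (kap * X)); last first.
    rewrite exprMn exprVn exprS.
    have -> : kap * (Num.sqrt g)^-1 * ((Num.sqrt g)^-1 * (g * g ^+ m) * X) =
        kap * (Num.sqrt g ^+ 2)^-1 * g * g ^+ m * X by field.
    by rewrite sqrtg_sqr; field; rewrite gn0 expf_neq0.
  have -> : 2 ^+ m.+1 * word_const p * '|x| = 2 ^+ m * (2 * word_const p * '|x|).
    by rewrite exprS; ring.
  by rewrite ler_wpM2l ?exprn_ge0 // /X mulrA ler_wpM2r ?rnorm_ge0.
have k_cases : k = 0%N \/ (0 < k)%N by case: (k); [left|right].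
case: k_cases => [k0|kgt0].
  apply: (main (al * cst)); first exact: al_cst_ge0.
    by rewrite k0 (mulrC (al * cst)); exact: RtEP_le.
  apply: (@le_trans _ _ (word_const p)); last first.
    by rewrite ler_peMl ?word_const_ge0 // ler1n.
  rewrite /word_const /p /= mulrAC; apply: ler_pM.
  - exact: mulr_ge0 al_ge0 (beta_ge0 _ _).
  - exact: cst_ge0.
  - by rewrite ler_wpM2l ?al_ge0 ?beta_le.
  - exact: cst_le_sqr.
apply: (main (2 * (dp * cst))); first exact: mulr_ge0 _ dp_cst_ge0.
  by rewrite kgt0 (mulrAC 2); exact: RtES_le.
rewrite -(mulrA 2) ler_wpM2l //.
(* Positive letters only would make the sum at least the length, contradicting [S < p]. *)
have nsb : same_blk k t = false.
  apply/negP => /(same_blk_size kgt0) h; move: Sp; rewrite /p /S /= ltnS leqNgt.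
  by rewrite -addn1 addnC leq_add.
rewrite /beta nsb /word_const /p /=.
have -> : dp ^+ size t = dp * dp ^+ (size t).-1.
  by rewrite -exprS; case: (t) nsb.
rewrite [leLHS](_ : _ = al * (dp * dp ^+ (size t).-1) * cst); last by ring.
rewrite ler_wpM2l ?cst_le_sqr //.
exact: mulr_ge0 al_ge0 (mulr_ge0 dp_ge0 (exprn_ge0 _ dp_ge0)).
Qed.

(** * Hilbert-Schmidt bounds and removal of the cut-off *)

Lemma word_linear t k x y : word t (k *: x + y) = k *: word t x + word t y.
Proof.
elim: t => [//|l t IH] /=.
by rewrite IH (diag_linear ipP uP _ _ _ (bdd_rk l)) pert_linear.
Qed.

Lemma word_rank_one t : 0%N \in t -> exists f e, forall x, word t x = f x *: e.
Proof.
elim: t => // -[|l] t IH; rewrite inE => /=.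
  move=> _; exists (fun x => - ip (u j) (word t x)), (E (u j)) => x.
  rewrite -pertZ scaleNr -dg_proj -scaleN1r -(rmorphN1 (@sreal R s)).
  rewrite -(diag_scale ipP uP _ _ bdd_proj); congr (E _).
  by apply: eq_diag => i _; rewrite mulN1r.
move=> /IH[f [e fe]]; exists f, (E (Rk l.+1 e)) => x.
by rewrite fe (diagZ ipP uP _ _ (bdd_rk _)) pertZ.
Qed.

Lemma word_hs n t : (0 < size t)%N ->
  hs_part d u n (fun x => Rh (size t) (sumn t) (word t x)) <=
    2 ^+ size t * 2^-1 ^+ sumn t * word_const (size t).
Proof.
move=> t0; set M := 2 ^+ size t * _ * _.
have M0 : 0 <= M.
  by rewrite mulr_ge0 ?word_const_ge0 // mulr_ge0 ?exprn_ge0 ?invr_ge0.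
apply: hs_part_le => //.
have lin k x y : Rh (size t) (sumn t) (word t (k *: x + y)) =
    k *: Rh (size t) (sumn t) (word t x) + Rh (size t) (sumn t) (word t y).
  by rewrite word_linear (diag_linear ipP uhP _ _ _ (bdd_rh _ _)).
suff [f [e fe]] : exists f e, forall x, Rh (size t) (sumn t) (word t x) = f x *: e.
  by apply: (rank_one_hs ipP uP n M0 lin fe) => x; exact: word_le.
have [ab|ba] := leqP (size t) (sumn t).
  exists (fun x => sreal s (- theta ^+ (sumn t - size t)) * ip (uh j) (word t x)), (uh j).
  by move=> x; rewrite Rh_neg // dgh_proj scalerA.
(* The sum is below the length, so the letters cannot all be positive. *)
have z : 0%N \in t.
  apply: contraTT ba; rewrite -leqNgt => {t0 M M0 lin}; elim: t => //= l t IH.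
  rewrite inE negb_or eq_sym -lt0n => /andP[l0 /IH h].
  by rewrite -addn1 addnC leq_add.
have [f [e fe]] := word_rank_one z; exists f, (Rh (size t) (sumn t) e) => x.
by rewrite fe (diagZ ipP uhP _ _ (bdd_rh _ _)).
Qed.

Lemma remainder_hs n L p : (0 < p)%N ->
  hs_part d u n (remainder L p) <= 4 ^+ p * word_const p.
Proof.
move=> p0; apply: (@le_trans _ _ (\sum_(t : p.-tuple 'I_L.+1)
    hs_part d u n (fun x => Rh p (sumn (map val t)) (word (map val t) x)))).
  exact: (hs_part_sum d u n).
apply: (@le_trans _ _ (nsum L p (fun t => (2^-1 : R) ^+ sumn t) *
                       (2 ^+ p * word_const p))).
  rewrite /nsum mulr_suml; apply: ler_sum => t _.
  have st_ : size (map val t) = p by rewrite size_map size_tuple.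
  have := @word_hs n (map val t); rewrite st_ => /(_ p0) /le_trans; apply.
  by rewrite mulrAC mulrC.
have -> : 4 ^+ p * word_const p = 2 ^+ p * (2 ^+ p * word_const p).
  by rewrite mulrA -exprMn -natrM.
by rewrite ler_wpM2r ?nsum_geometric // mulr_ge0 ?exprn_ge0 ?word_const_ge0.
Qed.

(** E = W^-1 (W E W) W^-1, and W^-1 is bounded because the eigenvalues are. *)
Lemma pert_bounded : exists2 e, 0 <= e & forall x, '|E x| <= e * '|x|.
Proof.
have [M wM] := bdd_winv.
have wM' k : in_dim d k -> `|winv k| <= `|M| by move=> /wM h; exact: le_trans (ler_norm M).
exists (`|M| * (dl * `|M|)); first by rewrite !mulr_ge0.
move=> x; rewrite -{1}(dg_wtK x).
have -> z : E z = dg winv (dg wt (E z)).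
  rewrite (diag_comp ipP uP _ bdd_winv bdd_wt) -[LHS](diag1 ipP uP).
  by apply: eq_diag => k dk; rewrite /wt mulfV // gt_eqF // winv_gt0.
apply: le_trans (rnorm_diag_bound ipP uP _ wM' _) _ => //.
rewrite -!mulrA ler_wpM2l //; apply: le_trans (WEW_le _) _.
by rewrite ler_wpM2l //; exact: (rnorm_diag_bound ipP uP _ wM' _).
Qed.

Lemma word_growth e t x : 0 <= e -> (forall y, '|E y| <= e * '|y|) ->
  '|word t x| <= e ^+ size t * g^-1 ^+ sumn t * '|x|.
Proof.
move=> e0 Ee; elim: t => [|l t IH] /=; first by rewrite !expr0 !mul1r.
apply: le_trans (Ee _) _.
have h := rnorm_diag_bound ipP uP (word t x) (@norm_rk_le l).
have {}h := h (exprn_ge0 _ _); rewrite invr_ge0 (ltW g_gt0) in h.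
apply: le_trans (ler_wpM2l e0 (h isT)) _.
rewrite exprS exprD -!mulrA ler_wpM2l // mulrCA ler_wpM2l ?exprn_ge0 ?invr_ge0 ?(ltW g_gt0) //.
by rewrite mulrA.
Qed.

(** The perturbed factor is theta^m hat P_j up to sign, with m = sumn t + L - q. The powers of [g]
    reduce to g^-q, and the m-th power of [tratio] is at most 2^-m, which also makes the sum over
    words converge. *)
Lemma truncation_le q : exists2 C, 0 <= C &
  forall L x, (q <= L)%N -> '|truncation L q x| <= 2^-1 ^+ L * C * '|x|.
Proof.
have [e e0 Ee] := pert_bounded; have gn0 : g != 0 by rewrite gt_eqF.
have C0 : 0 <= (2 * (e / g)) ^+ q by rewrite exprn_ge0 // mulr_ge0 // divr_ge0 // ltW.
exists ((2 * (e / g)) ^+ q * 2 ^+ q); first by rewrite mulr_ge0 // exprn_ge0.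
move=> L x qL; apply: le_trans (rnorm_sum _ _ _) _.
apply: (@le_trans _ _ (2^-1 ^+ L * (2 * (e / g)) ^+ q * '|x| *
    nsum L q (fun t => (2^-1 : R) ^+ sumn t))); last first.
  rewrite [leRHS](_ : _ = 2^-1 ^+ L * (2 * (e / g)) ^+ q * '|x| * 2 ^+ q); last by ring.
  apply: ler_wpM2l; last exact: nsum_geometric.
  apply: mulr_ge0 (rnorm_ge0 _); apply: mulr_ge0 C0.
  by rewrite exprn_ge0 // invr_ge0.
rewrite /nsum mulr_sumr; apply: ler_sum => t _.
set t' := map val t; have st' : size t' = q by rewrite size_map size_tuple.
have [m Sm] : exists m, (sumn t' + L = q + m)%N.
  by exists (sumn t' + L - q)%N; rewrite subnKC // (leq_trans qL) // leq_addl.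
rewrite Rh_neg; last by rewrite Sm leq_addr.
rewrite rnormZ_real normrN normrX Sm addKn theta_pow.
have h1 : '|dgh proj (Rk L (word t' x))| <= g^-1 ^+ L * (e ^+ q * g^-1 ^+ sumn t' * '|x|).
  apply: le_trans (rnorm_dgh_proj_le _) _.
  have gL0 : 0 <= g^-1 ^+ L by rewrite exprn_ge0 // invr_ge0 ltW.
  apply: le_trans (rnorm_diag_bound ipP uP _ (@norm_rk_le L) gL0) _.
  rewrite ler_wpM2l // -st'.
  exact: word_growth.
apply: le_trans (ler_wpM2l _ h1) _.
  by rewrite mulr_ge0 ?exprn_ge0 ?tratio_ge0 // ltW.
have gg : g ^+ m * (g^-1 ^+ L * g^-1 ^+ sumn t') = g^-1 ^+ q.
  by rewrite -exprD addnC Sm exprD mulrCA -exprMn mulfV // expr1n mulr1.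
have hh : 2^-1 ^+ L * 2^-1 ^+ sumn t' = 2^-1 ^+ q * 2^-1 ^+ m :> R.
  by rewrite -!exprD addnC Sm.
rewrite [leLHS](_ : _ = tratio ^+ m * (g ^+ m * (g^-1 ^+ L * g^-1 ^+ sumn t')) * e ^+ q * '|x|); last by ring.
rewrite [leRHS](_ : _ = (2^-1 ^+ L * 2^-1 ^+ sumn t') * (2 * (e / g)) ^+ q * '|x|); last by ring.
rewrite gg hh ler_wpM2r ?rnorm_ge0 //.
rewrite [leRHS](_ : _ = 2^-1 ^+ m * g^-1 ^+ q * e ^+ q); last first.
  have h2 : 2^-1 ^+ q * 2 ^+ q = 1 :> R by rewrite -exprMn mulVf ?expr1n.
  transitivity (2^-1 ^+ q * 2 ^+ q * (2^-1 ^+ m * g^-1 ^+ q * e ^+ q)).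
    by rewrite !exprMn; ring.
  by rewrite h2 mul1r.
rewrite ler_wpM2r ?exprn_ge0 // ler_wpM2r ?tratio_pow_le //.
by rewrite exprn_ge0 // invr_ge0 ltW.
Qed.

Lemma rnorm_sign n (x : H) : '|(-1) ^+ n *: x| = '|x|.
Proof. by rewrite -signr_odd; case: odd; rewrite ?expr1 ?scaleN1r ?rnormN // expr0 scale1r. Qed.

Lemma truncation_sum_le p : exists2 C, 0 <= C & forall L x, (p <= L)%N ->
  '|\sum_(0 <= n < p) (-1) ^+ n.+1 *: truncation L n x| <= 2^-1 ^+ L * C * '|x|.
Proof.
elim: p => [|p [C C0 IH]].
  by exists 0 => // L x _; rewrite big_geq // rnorm0 mulr0 mul0r.
have [C' C'0 h] := truncation_le p; exists (C + C'); first exact: addr_ge0.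
move=> L x pL; rewrite big_nat_recr //= mulrDr mulrDl.
apply: le_trans (rnormD _ _) _; rewrite rnorm_sign.
by apply: lerD; [exact: IH (ltnW pL)|exact: h (ltnW pL)].
Qed.

(** For fixed [n] the cut-off error vanishes as [L] grows, while the bound on the remainder depends
    neither on [n] nor on [L]. *)
Lemma perturbation_hs p : (0 < p)%N ->
  (hsnorm d u (fun x => eigenproj ip uh j x
     - \sum_(0 <= n < p) proj_term ip d lam u E j n x)%R
   <= (4 ^+ p * word_const p)%:E)%E.
Proof.
move=> p0; set D := fun x => _; set M := 4 ^+ p * _.
have M0 : 0 <= M by rewrite mulr_ge0 ?exprn_ge0 ?word_const_ge0.
suff hsM n : hs_part d u n D <= M.
  apply: hsnorm_le => // n; rewrite -[leLHS]sqr_sqrtr; last first.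
    by apply: sumr_ge0 => k _; exact: sqr_ge0.
  by apply: lerXn2r; rewrite ?nnegrE ?sqrtr_ge0 //; exact: hsM.
apply/ler_addgt0Pl => e e0; have [C C0 hC] := truncation_sum_le p.
pose A := n%:R * C / e.
have A0 : 0 <= A by rewrite divr_ge0 ?(ltW e0) // mulr_ge0.
(* [Num.bound A] exceeds [A] and is itself below 2^L, so the cut-off error n C / 2^L is at most
   [e]. *)
pose L := maxn p (Num.bound A); have pL : (p <= L)%N := leq_maxl _ _.
have AL : A <= 2 ^+ L.
  apply: le_trans (ltW (archi_boundP A0)) _; rewrite -natrX ler_nat.
  by apply: leq_trans (leq_maxr p _) _; rewrite -/L ltnW // ltn_expl.
have -> : D = (fun x => (-1) ^+ p.+1 *: remainder L p x
    + \sum_(0 <= k < p) (-1) ^+ k.+1 *: truncation L k x).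
  by apply/funext => x; exact: perturbation_expansion.
apply: le_trans (hs_partD _ _ _ _ _) _; rewrite addrC; apply: lerD.
  apply: (@le_trans _ _ (n%:R * (2^-1 ^+ L * C))).
    apply: (hs_part_le_bound ipP uP); last by move=> x; exact: hC.
    by rewrite mulr_ge0 ?exprn_ge0 ?invr_ge0.
  have p2 : 0 < 2 ^+ L :> R by rewrite exprn_gt0.
  rewrite exprVn mulrCA mulrC ler_pdivrMr // [e * _]mulrC -ler_pdivrMr //.
apply: le_trans (remainder_hs n L p0).
rewrite le_eqVlt; apply/orP; left; apply/eqP; congr Num.sqrt.
by apply: eq_bigr => k _; rewrite rnorm_sign.
Qed.

End Perturbation.

Theorem theorem1 (R : realType) (s : scalar_kind)
  (H : completeNormedModType (sfield R s)) (ip : H -> H -> sfield R s)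
  (ip_inner : inner_product ip)
  (d : option nat) (d_ge2 : if d is Some n then (2 <= n)%N else true)
  (Sigma Sigmah : {linear H -> H})
  (lam lamh : nat -> R) (u uh : nat -> H)
  (Sigma_sa : self_adjoint ip Sigma) (Sigmah_sa : self_adjoint ip Sigmah)
  (Sigma_compact : compact_op Sigma) (Sigmah_compact : compact_op Sigmah)
  (Sigma_pos : d = None -> positive_op ip Sigma)
  (Sigmah_pos : d = None -> positive_op ip Sigmah)
  (u_basis : orthonormal_basis ip d u) (uh_basis : orthonormal_basis ip d uh)
  (lam_mono : nonincreasing_eigenvalues d lam)
  (lamh_mono : nonincreasing_eigenvalues d lamh)
  (Sigma_dec : spectral_sum ip d Sigma lam u)
  (Sigmah_dec : spectral_sum ip d Sigmah lamh uh)
  (j : nat) (j_dim : in_dim d j) (gap_gt0 : 0 < spectral_gap d lam j) :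
  let E : H -> H := fun x => Sigmah x - Sigma x in
  let P := eigenproj ip u j in
  let S := sqrt_abs_resolvent ip d lam u j in
  let g := spectral_gap d lam j in
  let dl := delta ip d lam u E j in
  let dl' := delta' ip d lam u E j in
  (dl < (2^-1)%:E)%E ->
  forall p : nat, (1 <= p)%N ->
  (hsnorm d u (fun x => eigenproj ip uh j x
                 - \sum_(0 <= n < p) proj_term ip d lam u E j n x)%R
   <= (4 * (Num.sqrt g)^-1)%:E * hsnorm d u (P \o E \o S)
      * ((4%:E * dl') ^+ p.-1 * ((1 - 2 * fine dl) ^- 2)%:E))%E.
Proof.
move=> E P S g dl dl' dl_lt p p_gt0.
have dl_ge0 : (0 <= dl)%E := opnorm_ge0 _.
have dlE : dl = (fine dl)%:E.
  by rewrite fineK // ge0_fin_numE // (lt_trans dl_lt) // ltry.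
set D := fine dl in dlE *.
have D_ge0 : 0 <= D by rewrite -lee_fin -dlE.
have D_lt : D < 2^-1 by rewrite -lte_fin -dlE.
have dl_le : (dl <= D%:E)%E by rewrite -dlE.
have WEW := delta_le ip_inner u_basis lam_mono j_dim gap_gt0 dl_le.
(* This also makes [delta'] finite, so that the rest can be computed in [R]. *)
have dl'_le := delta'_le ip_inner u_basis lam_mono j_dim gap_gt0 D_ge0 WEW.
have dl'_ge0 : (0 <= dl')%E := delta'_ge0 ip d Sigma Sigmah lam u j.
have dl'E : dl' = (fine dl')%:E.
  by rewrite fineK // ge0_fin_numE // (le_lt_trans dl'_le) // ltry.
set D' := fine dl' in dl'E *.
have D'_le : D' <= D by rewrite -lee_fin -dl'E.
have dl'_leD' : (dl' <= D'%:E)%E by rewrite -dl'E.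
have [SES al_le PEP] := delta'_bounds ip_inner u_basis lam_mono j_dim gap_gt0 dl'_leD'.
apply: le_trans (perturbation_hs ip_inner Sigma_sa Sigmah_sa Sigma_pos u_basis uh_basis
  lam_mono lamh_mono Sigma_dec Sigmah_dec j_dim gap_gt0 D_ge0 D_lt WEW SES al_le PEP
  D'_le p_gt0) _.
have PES := hsnorm_PES_ge ip_inner Sigma_sa Sigmah_sa u_basis lam_mono j_dim gap_gt0.
have D'_ge0 : 0 <= D' by rewrite -lee_fin -dl'E.
have sg : 0 <= 4 * (Num.sqrt g)^-1 by rewrite mulr_ge0 // invr_ge0 sqrtr_ge0.
rewrite dl'E -EFinM -EFin_expe -EFinM.
apply: le_trans (lee_wpmul2r _ (lee_wpmul2l _ PES)); last 2 first.
- by rewrite lee_fin mulr_ge0 ?exprn_ge0 ?mulr_ge0 // invr_ge0 sqr_ge0.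
- by rewrite lee_fin.
rewrite -!EFinM lee_fin /word_const /cst /al -/g.
(* One factor 4 goes with g^{-1/2} ||P_j E S||, the remaining ones with the powers of [delta']. *)
case: p p_gt0 => // p _; rewrite le_eqVlt; apply/orP; left; apply/eqP.
rewrite /= exprMn exprVn exprS.
by ring.
Qed.
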